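(* Let $\Phi$ be a $\mathbf{\Phi}$-function such that $t\mapsto\Phi(t)t^{-p}$ is increasing on $(0,\infty)$ for some $p\ge2$. There exist a positive universal numerical constant $c\ge1$ and a number $C(\Phi,p)\ge1$, depending only on $\Phi$ and $p$, such that for every compact $\Omega\subset\mathbb{R}^d$, every Borel probability measure $\mu$ on $\Omega$, every function class $\mathbf{F}\subset C(\Omega)$ and every $N\ge1$, one has $$\varrho_{cN}(\mathbf{F},\|\cdot\|_{L^\Phi(\mu)})\le C(\Phi,p)\Bigl(\frac{\Phi(\sqrt N)}{N}\Bigr)^{1/p}d_N(\mathbf{F},\|\cdot\|_\infty).$$
   Context: ''Increasing'' is meant in the non-strict sense. A $\mathbf{\Phi}$-function is an increasing function $\Phi:[0,\infty)\to[0,\infty)$ with $\Phi(0)=0$, $\lim_{t\to0+}\Phi(t)=0$, $\lim_{t\to\infty}\Phi(t)=\infty$, such that $t\mapsto\Phi(t)t^{-1}$ is almost increasing on $(0,\infty)$, i.e. there is $a\ge1$ with $\Phi(s)s^{-1}\le a\,\Phi(t)t^{-1}$ for all $0<s<t$. $C(\Omega)$ is the space of continuous complex-valued functions on $\Omega$, $\|f\|_\infty=\max_\Omega|f|$. $\|f\|_{L^\Phi(\mu)}:=\inf\{\lambda>0:\int_\Omega\Phi(|f|/\lambda)\,d\mu\le1\}$, and $L^\Phi(\mu)$ is the space of (classes of) measurable $f$ for which $\int\Phi(|f|/\lambda)\,d\mu<\infty$ for some $\lambda>0$. Sampling numbers: for real $m\ge1$, $$\varrho_m(\mathbf{F},\|\cdot\|_{L^\Phi(\mu)}):=\inf_{\mathbf{x}}\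 \inf_{T_{\mathbf{x}}}\ \sup_{f\in\mathbf{F}}\|f-T_{\mathbf{x}}(f(x_1),\dots,f(x_k))\|_{L^\Phi(\mu)},$$ where the first infimum is over finite sets $\mathbf{x}=\{x_1,\dots,x_k\}\subset\Omega$ with $k\le m$ and the second over linear maps $T_{\mathbf{x}}:\mathbb{C}^k\to L^\Phi(\mu)$. Kolmogorov widths: $d_N(\mathbf{F},\|\cdot\|_\infty):=\inf_{X_N}\sup_{f\in\mathbf{F}}\inf_{u\in X_N}\|f-u\|_\infty$, the infimum being over $N$-dimensional subspaces $X_N\subset C(\Omega)$.
   Formalization: The inequality is stated only for those N with Φ(√N) > 0; where Φ(√N) = 0 the right-hand side is 0 and the claim fails, e.g. Φ(t) = max(t−10,0)², p = 2, N = 1, Ω = [0,1] with Lebesgue measure, F the unit ball of C(Ω). *)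

(* Defs.v *)
From HB Require Import structures.
From mathcomp Require Import all_boot all_order all_algebra complex.
From mathcomp Require Import all_classical all_reals all_analysis.

Set Implicit Arguments.
Unset Strict Implicit.
Unset Printing Implicit Defensive.

Import Order.TTheory GRing.Theory Num.Theory.
Import numFieldNormedType.Exports.

Local Open Scope classical_set_scope.
Local Open Scope complex_scope.
Local Open Scope ring_scope.

(* A topological space with its Borel sigma-algebra. *)
Notation borel T := (g_sigma_algebraType (@open T)).

(* The complex numbers. The regular algebra R[i]^o is the form of R[i] that
   carries the topology; Normc.normc is the modulus as an element of R. *)
Notation Cplx R := (R[i]^o).

(* A function [0, oo) -> [0, oo) is represented by a map R -> R whose values at
   negative arguments are irrelevant; "increasing" is non-strict. *)
Definition Phi_function (R : realType) (Phi : R -> R) : Prop :=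
  [/\ [/\ forall t, 0 <= t -> 0 <= Phi t,
          forall s t, 0 <= s -> s <= t -> Phi s <= Phi t
        & Phi 0 = 0],
      Phi t @[t --> 0^'+] --> (0 : R),
      Phi t @[t --> +oo] --> +oo
    & exists2 a, 1 <= a &
        forall s t, 0 < s -> s < t -> Phi s * s^-1 <= a * (Phi t * t^-1)].

Section OrliczSampling.
Context {R : realType} {disp : measure_display} {T : measurableType disp}.
Variables (mu : {measure set T -> \bar R}) (D : set T) (Phi : R -> R).

(* The integral over D of Phi(|f| / lambda). *)
Definition modular (f : T -> Cplx R) (lambda : R) : \bar R :=
  (\int[mu]_(t in D) (Phi (Normc.normc (f t) / lambda))%:E)%E.

(* An extended real, with inf of the empty set equal to +oo. *)
Definition LPhi_norm (f : T -> Cplx R) : \bar R :=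
  ereal_inf [set lambda%:E | lambda in
    [set lambda : R | 0 < lambda /\ (modular f lambda <= 1)%E]].

Definition in_LPhi (f : T -> Cplx R) : Prop :=
  measurable_fun D (f : T -> borel (Cplx R)) /\
  exists2 lambda : R, 0 < lambda & (modular f lambda < +oo)%E.

(* The elements of L^Phi(mu) are classes modulo almost everywhere equality: a
   linear map into L^Phi(mu) is given by a choice of representatives, so that
   linearity holds almost everywhere on D. *)
Definition linear_to_LPhi (k : nat) (A : 'rV[R[i]]_k -> T -> Cplx R) : Prop :=
  (forall v, in_LPhi (A v)) /\
  (forall (a : R[i]) (v w : 'rV[R[i]]_k),
     {ae mu, forall t, D t -> A (a *: v + w) t = a * A v t + A w t}).

(* sup over f in F of || f - A (f(x_1), ..., f(x_k)) || in L^Phi(mu) *)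
Definition recovery_error (F : set (T -> Cplx R)) (k : nat) (x : 'I_k -> T)
    (A : 'rV[R[i]]_k -> T -> Cplx R) : \bar R :=
  ereal_sup [set LPhi_norm (fun t => f t - A (\row_i f (x i)) t) | f in F].

(* The injective x : 'I_k -> D enumerate the subsets of D with k elements. *)
Definition sampling_number (F : set (T -> Cplx R)) (m : R) : \bar R :=
  ereal_inf [set e | exists k : nat, exists x : 'I_k -> T,
    [/\ k%:R <= m, injective x, forall i, D (x i)
      & e = ereal_inf [set recovery_error F x A | A in @linear_to_LPhi k]]].

End OrliczSampling.

(* C(D) is represented by functions on the ambient space X that are continuous
   on D; their values outside D play no role in any definition. *)
Section KolmogorovWidth.
Context {R : realType} {X : topologicalType}.
Variable D : set X.

Definition continuous_on : set (X -> Cplx R) :=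
  [set f | {within D, continuous f}].

Definition sup_norm (f : X -> Cplx R) : \bar R :=
  ereal_sup [set (Normc.normc (f t))%:E | t in D].

(* V is the span of N elements of C(D) that are linearly independent on D. *)
Definition subspace_of_dim (N : nat) (V : set (X -> Cplx R)) : Prop :=
  exists b : 'I_N -> X -> Cplx R,
    [/\ forall i, continuous_on (b i),
        forall a : 'I_N -> R[i],
          (forall t, D t -> \sum_i a i * b i t = 0) -> forall i, a i = 0
      & V = [set u | exists a : 'I_N -> R[i],
                       u = (fun t => \sum_i a i * b i t)]].

Definition kolmogorov_width (F : set (X -> Cplx R)) (N : nat) : \bar R :=
  ereal_inf [set
    ereal_sup [set
      ereal_inf [set sup_norm (fun t => f t - u t) | u in V] | f in F]
    | V in subspace_of_dim N].

End KolmogorovWidth.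

(* Main.v *)
Require Import Defs.
From HB Require Import structures.
From mathcomp Require Import all_boot all_order all_algebra complex.
From mathcomp Require Import all_classical all_reals all_analysis.
From mathcomp Require Import perm measurable_realfun ring lra.

Import Order.TTheory GRing.Theory Num.Theory.
Import numFieldNormedType.Exports.

Local Open Scope classical_set_scope.
Local Open Scope complex_scope.
Local Open Scope ring_scope.

(** Let V be an N-dimensional subspace of C(Omega) within e of every f in F, in
    the uniform norm.  It suffices to find 8N points x_l of Omega such that every
    u in V satisfies

      N * int |u|^2 dmu <= 2 S(u)  and  sup |u|^2 <= 24 S(u),
      where S(u) = sum_l |u(x_l)|^2.

    The recovery operator is then the (unweighted) least squares fit at these
    points, a linear map Q from samples to V which fixes V.  If u in V
    has |f - u| <= e, then w = Qf - u is the fit of the data (f - u)(x_l), so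
    S(w) <= 8N e^2, because a least squares fit is an orthogonal projection.
    Therefore int |w|^2 dmu <= 16 e^2 and sup |w|^2 <= 192 N e^2, and the error
    h = f - Qf satisfies similar bounds, with |h| <= 20 sqrt(N) e.  Since p >= 2,
    Phi(t)/t^2 is increasing, so for lambda = 20 s e and M = sqrt(N)/s one has
    Phi(|h|/lambda) <= Phi(M) |h|^2 / (400 N e^2), whose integral is at most
    Phi(M)/N.  Since Phi(t)/t^p is increasing, Phi(M) <= s^-p Phi(sqrt N), and
    this is at most N when s is a large enough multiple of
    (Phi(sqrt N)/N)^(1/p) with s >= 1; the latter is possible because
    Phi(sqrt N)/N stays away from 0 once it is positive.
    (See LPhi_norm_le, Phi_rescaled_le and Phi_ratio_lower_bound.)

    The points are found in two steps.  Regard V as a real space of dimension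
    n = 2N and the real and imaginary parts of the evaluations as vectors v_j of
    R^n, j ranging over pairs (point, part).

    Uniform norm (sup_norming_indices).  Among all families of 2n indices take
    one whose Gram determinant is within a factor 2 of the supremum.  The
    leverages v_i G^-1 v_i of its members add up to n, so some member has
    leverage at most 1/2; replacing it by an arbitrary v_j cannot raise the
    determinant much, which bounds v_j by the Gram form of the family, with a
    constant independent of n.

    L2 norm (subsampling).  Average the measure mu with the uniform measure on
    these 2n indices.  Its Gram matrix G dominates both norms to be controlled.
    The lower half of the Batson-Spielman-Srivastava barrier argument selects 4n
    indices, with equal weights, whose Gram form is at least n G.  Keeping only
    the lower barrier is what makes equal weights possible, and it
    requires no bound on the size of the v_j: at each step a suitable index exists
    just because some index is above average for a given quadratic form
    (exists_above_average). *)

(** * Quadratic forms *)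

Definition form {R : realType} {n} (M : 'M[R]_n) (u w : 'rV[R]_n) : R :=
  (u *m M *m w^T) 0 0.

Definition psd {R : realType} {n} (M : 'M[R]_n) :=
  M^T = M /\ forall u, 0 <= form M u u.

Definition pd {R : realType} {n} (M : 'M[R]_n) :=
  M^T = M /\ forall u, u != 0 -> 0 < form M u u.

Section forms.
Context {R : realType} {n : nat}.
Implicit Types (M Q : 'M[R]_n) (u v w a : 'rV[R]_n).

Lemma form_trace M u : form M u u = \tr (M *m (u^T *m u)).
Proof. by rewrite mulmxA mxtrace_mulC mulmxA /form [RHS]big_ord1. Qed.

Lemma formDl M u v w : form M (u + v) w = form M u w + form M v w.
Proof. by rewrite /form !mulmxDl mxE. Qed.

Lemma formDr M u v w : form M u (v + w) = form M u v + form M u w.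
Proof. by rewrite /form linearD mulmxDr mxE. Qed.

Lemma formZl M k u w : form M (k *: u) w = k * form M u w.
Proof. by rewrite /form -!scalemxAl mxE. Qed.

Lemma formZr M k u w : form M u (k *: w) = k * form M u w.
Proof. by rewrite /form linearZ -!scalemxAr mxE. Qed.

Lemma formDm M Q u w : form (M + Q) u w = form M u w + form Q u w.
Proof. by rewrite /form mulmxDr mulmxDl mxE. Qed.

Lemma formZm k M u w : form (k *: M) u w = k * form M u w.
Proof. by rewrite /form -scalemxAr -scalemxAl mxE. Qed.

Lemma formBm M Q u w : form (M - Q) u w = form M u w - form Q u w.
Proof. by rewrite -scaleN1r formDm formZm mulN1r. Qed.

Lemma form_sum (I : Type) (r : seq I) (P : pred I) (F : I -> 'M[R]_n) u w :
  form (\sum_(i <- r | P i) F i) u w = \sum_(i <- r | P i) form (F i) u w.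
Proof.
rewrite /form mulmx_sumr mulmx_suml summxE //.
Qed.

Lemma form_conj M X u w : form (X *m M *m X^T) u w = form M (u *m X) (w *m X).
Proof. by rewrite /form trmx_mul !mulmxA. Qed.

Lemma formC M u w : M^T = M -> form M u w = form M w u.
Proof.
move=> sM; rewrite /form.
have <- : (u *m M *m w^T)^T = w *m M *m u^T by rewrite !trmx_mul trmxK sM mulmxA.
by rewrite [RHS]mxE.
Qed.

Lemma form1C u w : form 1%:M u w = form 1%:M w u.
Proof. by apply: formC; rewrite trmx1. Qed.

Lemma form1E u w : form 1%:M u w = \sum_i u 0 i * w 0 i.
Proof. by rewrite /form mulmx1 mxE; apply: eq_bigr => i _; rewrite mxE. Qed.

Lemma form1_gt0 u : u != 0 -> 0 < form 1%:M u u.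
Proof.
move=> u0; rewrite lt_neqAle form1E sumr_ge0 ?andbT; last first.
  by move=> i _; rewrite -expr2 sqr_ge0.
apply: contra u0 => /eqP /esym /eqP; rewrite psumr_eq0; last first.
  by move=> i _; rewrite -expr2 sqr_ge0.
move=> /allP u0; apply/eqP/rowP => i; rewrite mxE.
by have := u0 i (mem_index_enum _); rewrite mulf_eq0 orbb => /eqP.
Qed.

Lemma form_rank1 v a : form (v^T *m v) a a = (form 1%:M v a) ^+ 2.
Proof.
rewrite /form !mulmxA mulmx1 -mulmxA [LHS]mxE big_ord1 expr2; congr (_ * _).
have <- : (v *m a^T)^T = a *m v^T by rewrite trmx_mul trmxK.
by rewrite [LHS]mxE.
Qed.

Lemma sym_rank1 v : (v^T *m v)^T = v^T *m v.
Proof. by rewrite trmx_mul trmxK. Qed.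

Lemma pd_psd M : pd M -> psd M.
Proof.
move=> [sM pM]; split=> // u; have [->|/pM/ltW//] := eqVneq u 0.
by rewrite /form !mul0mx mxE.
Qed.

Lemma psd_rank1 v : psd (v^T *m v).
Proof. by split=> [|a]; rewrite ?sym_rank1// form_rank1 sqr_ge0. Qed.

Lemma psdD M Q : psd M -> psd Q -> psd (M + Q).
Proof.
move=> [sM pM] [sQ pQ]; split; first by rewrite linearD /= sM sQ.
by move=> u; rewrite formDm addr_ge0.
Qed.

Lemma psdZ k M : 0 <= k -> psd M -> psd (k *: M).
Proof.
move=> k0 [sM pM]; split; first by rewrite linearZ /= sM.
by move=> u; rewrite formZm mulr_ge0.
Qed.

Lemma psd_sum (I : Type) (r : seq I) (P : pred I) (F : I -> 'M[R]_n) :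
  (forall i, P i -> psd (F i)) -> psd (\sum_(i <- r | P i) F i).
Proof.
move=> pF; elim/big_ind : _ => //; last by move=> ? ?; exact: psdD.
by split=> [|u]; rewrite ?trmx0// /form mulmx0 mul0mx mxE.
Qed.

Lemma pdD M Q : pd M -> psd Q -> pd (M + Q).
Proof.
move=> [sM pM] [sQ pQ]; split; first by rewrite linearD /= sM sQ.
by move=> u u0; rewrite formDm ltr_wpDr// pM.
Qed.

Lemma psd_cauchy_schwarz {M} u w :
  psd M -> form M u w ^+ 2 <= form M u u * form M w w.
Proof.
move=> [sM pM].
have q s t : 0 <= s ^+ 2 * form M u u + 2 * s * t * form M u w
                  + t ^+ 2 * form M w w.
  have := pM (s *: u + t *: w).
  rewrite !(formDl, formDr, formZl, formZr) [form M w u]formC//.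
  by move=> /le_trans; apply; lra.
move: (pM u) (pM w) q; set A := form M u u; set B := form M u w.
set C := form M w w => A0 C0 q.
have [C1|C1] := ltP 0 C.
  by move: (q C (- B)) => {}q; rewrite -(ler_pM2l C1); lra.
have Cz : C = 0 by apply/le_anti; rewrite C0 C1.
have := q (- B) (A + 1); have := mulr_ge0 A0 (sqr_ge0 B); rewrite Cz; lra.
Qed.

Lemma pd_unit {M} : pd M -> M \in unitmx.
Proof.
move=> [sM pM]; rewrite -row_free_unit -kermx_eq0; apply/negPn/negP => /rowV0Pn.
move=> [u /sub_kermxP uM u0]; have := pM _ u0.
by rewrite /form uM mul0mx mxE ltxx.
Qed.

(** If [form M u u] vanishes then Cauchy-Schwarz makes [u] orthogonal, for the
    form, to [u *m M], that is, [u *m M] has norm zero. *)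
Lemma psd_unit_pd {M} : psd M -> M \in unitmx -> pd M.
Proof.
move=> pM uM; split=> [|u u0]; first by case: pM.
rewrite lt_neqAle (proj2 pM) andbT eq_sym; apply/negP => /eqP u1.
have H := psd_cauchy_schwarz u (u *m M) pM; rewrite u1 mul0r in H.
have /form1_gt0 : u *m M != 0.
  by apply: contra u0 => /eqP H0; rewrite -(mulmxK uM u) H0 mul0mx.
rewrite /form mulmx1 => z0; move: H.
by rewrite /form leNgt exprn_gt0.
Qed.

Lemma pd_inv {M} : pd M -> pd (invmx M).
Proof.
move=> pM; have uM := pd_unit pM; case: (pM) => sM fM; split.
  by rewrite trmx_inv sM.
move=> u u0; have := fM (u *m invmx M).
rewrite /form mulmxKV// trmx_mul trmx_inv sM mulmxA; apply.
by apply: contra u0 => /eqP H0; rewrite -(mulmxKV uM u) H0 mul0mx.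
Qed.

(** Cauchy-Schwarz for the form [M], applied to [u] and [w *m invmx M]. *)
Lemma dual_cauchy_schwarz {M} u w : pd M ->
  form 1%:M u w ^+ 2 <= form M u u * form (invmx M) w w.
Proof.
move=> pM; have := psd_cauchy_schwarz u (w *m invmx M) (pd_psd _ pM).
have uM := pd_unit pM; case: pM => sM _.
by rewrite /form mulmxKV// trmx_mul trmx_inv sM !mulmxA mulmxK// mulmx1.
Qed.

Lemma psd_trace_ge0 {M} : psd M -> 0 <= \tr M.
Proof.
move=> [_ pM]; apply: sumr_ge0 => i _; have := pM (delta_mx 0 i).
by rewrite /form -rowE trmx_delta -colE !mxE.
Qed.

(** The matrix determinant lemma, read off two triangular factorizations of the
    same block matrix. *)
Lemma det_rank1 M u v : M \in unitmx ->
  \det (M + u^T *m v) = \det M * (1 + form (invmx M) v u).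
Proof.
move=> uM.
have -> : M + u^T *m v = M *m (1%:M + (invmx M *m u^T) *m v).
  by rewrite mulmxDr mulmx1 !mulmxA mulmxV// mul1mx.
rewrite det_mulmx; congr (_ * _).
set x := invmx M *m u^T.
(* Both sides equal [block_mx 1%:M (- v) x 1%:M]. *)
have E : block_mx 1%:M 0 x 1%:M *m block_mx 1%:M (- v) 0 (1%:M + x *m v)
   = block_mx (1%:M + v *m x) (- v) 0 1%:M *m block_mx (1%:M : 'M[R]_1) 0 x 1%:M.
  rewrite !mulmx_block !mulmx1 !mulmx0 !mul0mx !mul1mx !addr0 !add0r !mulNmx.
  by rewrite addrK mulmxN addrC addrK.
have := congr1 (@determinant _ _) E; rewrite !det_mulmx !det_lblock !det_ublock.
rewrite !det1 !mul1r !mulr1 => ->.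
by rewrite [LHS]det_mx11 /form -mulmxA -/x [LHS]mxE; congr (_ + _); rewrite mxE.
Qed.

End forms.

(** * One-sided sparsification of an averaged quadratic form *)

Lemma form_block {R : realType} {n} (a x : R) (b u : 'rV[R]_n) (D : 'M[R]_n) :
  form (block_mx a%:M b b^T D) (row_mx x%:M u) (row_mx x%:M u)
  = a * x ^+ 2 + 2 * x * form 1%:M b u + form D u u.
Proof.
rewrite {1}/form (mul_row_block x%:M u a%:M b) (tr_row_mx x%:M u).
rewrite mul_row_col !mulmxDl tr_scalar_mx -!mulmxA !mul_scalar_mx.
rewrite !mul_mx_scalar -!scalemxAr.
have -> : form 1%:M b u = (u *m b^T) 0 0 by rewrite form1C /form mulmx1.
have : (b *m u^T) 0 0 = (u *m b^T) 0 0.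
  by rewrite -[u *m b^T]trmxK [RHS]mxE trmx_mul trmxK.
have -> : form D u u = (u *m (D *m u^T)) 0 0 by rewrite /form mulmxA.
move: (b *m u^T) (u *m b^T) (u *m (D *m u^T)) => B1 B2 B3 E.
by rewrite !mxE E eqxx mulr1n; ring.
Qed.

Lemma cholesky_block {R : realType} {n} (a : R) (b : 'rV[R]_n) (S : 'M[R]_n) :
  0 < a ->
  let X := block_mx (Num.sqrt a)%:M ((Num.sqrt a)^-1 *: b) 0 S in
  block_mx a%:M b b^T (a^-1 *: (b^T *m b) + S^T *m S) = X^T *m X.
Proof.
move=> a0; set r := Num.sqrt a.
have r0 : r != 0 by rewrite gt_eqF// sqrtr_gt0.
have rr : r ^+ 2 = a by rewrite sqr_sqrtr// ltW.
rewrite /= (tr_block_mx r%:M) (mulmx_block (r%:M)^T) !trmx0 !mul0mx !mulmx0 !addr0.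
rewrite tr_scalar_mx -scalar_mxM -expr2 rr mul_scalar_mx scalerA divff// scale1r.
rewrite mul_mx_scalar linearZ /= scalerA divff// scale1r.
by rewrite -scalemxAl -scalemxAr scalerA -invfM -expr2 rr.
Qed.

(** Induction on the size: after the first row and column are cleared, the Schur
    complement is positive definite, because its value at [u] is the value of
    [G] at [u] extended by the minimizing first coordinate. *)
Lemma cholesky {R : realType} {n} (G : 'M[R]_n) :
  pd G -> exists S : 'M[R]_n, G = S^T *m S.
Proof.
elim: n G => [|n IH] G pG.
  by exists 0; rewrite [RHS]flatmx0 [LHS]flatmx0.
case: (pG) => sG fG; pose G' : 'M[R]_(1 + n) := G.
set a := G 0 0; set b : 'rV[R]_n := ursubmx G'; set D : 'M[R]_n := drsubmx G'.
have GE : G = block_mx (a%:M) b (b^T) D :> 'M[R]_(1 + n).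
  rewrite -[LHS](submxK G'); congr block_mx.
    by rewrite [LHS]mx11_scalar !mxE; congr (_%:M); congr (G _ _); apply: val_inj.
  by rewrite /b trmx_ursub; congr (dlsubmx _); rewrite /G' sG.
have sD : D^T = D by rewrite trmx_drsub /G' sG.
have a0 : 0 < a.
  have e0 : delta_mx 0 0 != 0 :> 'rV[R]_n.+1.
    by apply/eqP => /rowP/(_ 0); rewrite !mxE !eqxx => /eqP; rewrite oner_eq0.
  by have := fG _ e0; rewrite /form -rowE trmx_delta -colE !mxE.
have pD : pd (D - a^-1 *: (b^T *m b)).
  split; first by rewrite linearB /= linearZ /= sym_rank1 sD.
  move=> u u0; rewrite formBm formZm form_rank1; set k := form 1%:M b u.
  (* The first coordinate that minimizes the form on the line through [u]. *)
  have /fG : row_mx (- a^-1 * k)%:M u != 0 :> 'rV[R]_(1 + n).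
    apply: contra u0 => /eqP H; apply/eqP/rowP => i.
    by move/rowP: H => /(_ (rshift 1 i)); rewrite (row_mxEr (_)%:M u) !mxE.
  rewrite GE (form_block a _ b u D) -/k => /lt_le_trans; apply.
  rewrite le_eqVlt; apply/orP; left; apply/eqP; field; exact: lt0r_neq0.
have [S SE] := IH _ pD.
exists (block_mx (Num.sqrt a)%:M ((Num.sqrt a)^-1 *: b) 0 S : 'M[R]_(1 + n)).
rewrite GE; have -> : D = a^-1 *: (b^T *m b) + S^T *m S by rewrite -SE addrC subrK.
exact: cholesky_block.
Qed.

Section step.
Context {R : realType} {n : nat}.
Implicit Types (B P Q : 'M[R]_n) (v : 'rV[R]_n).

(** A Lagrange identity: twice the difference of the two sides is the sum over
    [i] and [j] of the form [Q] at [v_i e_j - v_j e_i]. *)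
Lemma form_le_trace Q v : psd Q -> form Q v v <= \tr Q * form 1%:M v v.
Proof.
move=> [sQ pQ].
pose e i : 'rV[R]_n := delta_mx 0 i.
have eQ i j : form Q (e i) (e j) = Q i j.
  by rewrite /form -rowE trmx_delta -colE !mxE.
have Qij i j : 2 * v 0 i * v 0 j * Q i j <= v 0 i ^+ 2 * Q j j + v 0 j ^+ 2 * Q i i.
  have := pQ (v 0 i *: e j - v 0 j *: e i).
  rewrite -scaleNr !(formDl, formDr, formZl, formZr) !eQ.
  have -> : Q j i = Q i j by rewrite -{1}sQ mxE.
  by move=> H; rewrite -subr_ge0; apply: (le_trans H); lra.
have -> : form Q v v = \sum_i \sum_j v 0 i * v 0 j * Q i j.
  rewrite /form -mulmxA mxE; apply: eq_bigr => i _.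
  rewrite mxE mulr_sumr; apply: eq_bigr => j _.
  by rewrite mxE; ring.
rewrite form1E /mxtrace.
have -> : (\sum_i Q i i) * (\sum_i v 0 i * v 0 i)
   = \sum_i \sum_j (v 0 i ^+ 2 * Q j j).
  rewrite mulr_sumr; apply: eq_bigr => i _; rewrite mulr_suml.
  by apply: eq_bigr => j _; rewrite mulrC expr2.
rewrite -(ler_pM2l (ltr0Sn R 1)).
have -> : 2 * (\sum_i \sum_j v 0 i ^+ 2 * Q j j)
   = \sum_i \sum_j (v 0 i ^+ 2 * Q j j + v 0 j ^+ 2 * Q i i).
  under [RHS]eq_bigr => i _ do rewrite big_split /=.
  rewrite big_split /= [X in _ + X]exchange_big /= mulrDl !mul1r //.
rewrite mulr_sumr; apply: ler_sum => i _; rewrite mulr_sumr.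
by apply: ler_sum => j _; rewrite !mulrA.
Qed.

Lemma sherman_morrison B v s : pd B -> 0 <= s ->
  invmx (B + s *: (v^T *m v)) =
  invmx B - (s / (1 + s * form (invmx B) v v)) *: (invmx B *m v^T *m v *m invmx B).
Proof.
move=> pB s0; set P := invmx B; set q := form P v v.
have q0 : 0 <= q by have [_] := pd_psd _ (pd_inv pB); exact.
have sq : 1 + s * q != 0 by rewrite gt_eqF// ltr_pwDl// mulr_ge0.
set k := s / _; set C := B + _; have uB := pd_unit pB.
have E : C *m (P - k *: (P *m v^T *m v *m P)) = 1%:M.
  rewrite mulmxBr /C mulmxDl mulmxV// -scalemxAl -scalemxAr mulmxDl.
  have -> : B *m (P *m v^T *m v *m P) = v^T *m v *m P.
    by rewrite !mulmxA mulmxV// mul1mx.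
  have -> : s *: (v^T *m v) *m (P *m v^T *m v *m P) = (s * q) *: (v^T *m v *m P).
    rewrite -scalemxAl !mulmxA -[v^T *m v *m P *m v^T]mulmxA.
    rewrite -[v^T *m v *m _]mulmxA [v *m (P *m v^T)]mx11_scalar mulmxA -/q.
    by rewrite mul_mx_scalar -!scalemxAl scalerA.
  set X := v^T *m v *m P; rewrite -[X in k *: (X + _)]scale1r -scalerDl scalerA.
  by rewrite -addrA -scalerBl mulrC mulrC divfK// subrr scale0r addr0.
have uC : C \in unitmx by have := mulmx1_unit E; case.
by rewrite -[LHS]mulmx1 -E mulKmx.
Qed.

Lemma trace_sherman_morrison B v s : pd B -> 0 <= s ->
  \tr (invmx (B + s *: (v^T *m v))) =
  \tr (invmx B) - s * form (invmx B *m invmx B) v v / (1 + s * form (invmx B) v v).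
Proof.
move=> pB s0; rewrite sherman_morrison// linearB /= linearZ /=; congr (_ - _).
rewrite mulrAC; congr (_ * _ * _).
by rewrite form_trace [LHS]mxtrace_mulC !mulmxA.
Qed.

End step.

Section barrier.
Context {R : realType} {n : nat}.
Implicit Types (B P Q : 'M[R]_n) (v : 'rV[R]_n).

(** With [B = S^T S] the trace of the product is that of [S Q S^T], a positive
    semidefinite matrix. *)
Lemma trace_pd_mul {B Q} : pd B -> psd Q -> 0 <= \tr (B *m Q).
Proof.
move=> /cholesky[S ->] [sQ pQ]; rewrite mxtrace_mulC mulmxA mxtrace_mulC mulmxA.
apply: psd_trace_ge0; split=> [|u]; first by rewrite !trmx_mul trmxK sQ mulmxA.
by rewrite form_conj.
Qed.

(** The inverse of every eigenvalue of [B] is at most the potential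
    [\tr (invmx B)]; when the latter is at most 1/2, the eigenvalues are at least 2
    and there is room to move the barrier by 1. *)
Lemma barrier_shift B : pd B -> \tr (invmx B) <= 1 / 2 -> pd (B - 1%:M).
Proof.
move=> pB tB; split; first by rewrite linearB /= trmx1 (proj1 pB).
move=> u u0; rewrite formBm; have f1 := form1_gt0 _ u0.
have := dual_cauchy_schwarz u u pB.
have := form_le_trace _ u (pd_psd _ (pd_inv pB)).
have := proj2 pB _ u0.
move: (form 1%:M u u) (form B u u) f1 (form (invmx B) u u) (\tr (invmx B)) tB.
move=> x y x0 z t t2 y0 zt xyz.
have : x ^+ 2 <= y * (t * x) by apply: (le_trans xyz); rewrite ler_pM2l.
rewrite mulrA expr2 ler_pM2r// => xy.
have : y * t <= y * (1 / 2) by rewrite ler_pM2l.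
by rewrite subr_gt0; lra.
Qed.

(** The heart of the barrier argument.  Put [P = (B - 1)^-1], [Q = B^-1] and
    [D = tr P - tr Q], the increase of the potential caused by moving the barrier.
    By Sherman-Morrison, adding [2 v^T v] undoes this increase as soon as
    [D (1 + 2 v P v^T) <= 2 v P^2 v^T].  An index for which the form
    [P^2 - D P] is above its trace will do.  Indeed [P - Q = P Q], so the trace of
    that form is [D + tr (P Q P) - D tr P], where [tr P <= 1/2 + D], and
    Cauchy-Schwarz for [Q] gives [D^2 = (tr P Q)^2 <= tr (P Q P) tr Q]; as
    [tr Q <= 1/2] this bounds the trace from below by [D/2]. *)
Lemma barrier_step (J : Type) (v : J -> 'rV[R]_n) B :
  (forall M, exists j, \tr M <= form M (v j) (v j)) ->
  pd B -> \tr (invmx B) <= 1 / 2 ->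
  exists j, let B' := B - 1%:M + 2 *: ((v j)^T *m v j) in
    pd B' /\ \tr (invmx B') <= 1 / 2.
Proof.
move=> H pB tB; have pB1 := barrier_shift _ pB tB.
set P := invmx (B - 1%:M); set Q := invmx B.
have uB := pd_unit pB; have uB1 := pd_unit pB1.
have pP : pd P := pd_inv pB1; have pQ : pd Q := pd_inv pB.
have PQ : P - Q = P *m Q.
  have -> : P *m Q = P *m (B - (B - 1%:M)) *m Q by rewrite opprB addrC subrK mulmx1.
  by rewrite mulmxBr mulmxBl mulVmx// mul1mx -mulmxA mulmxV// mulmx1.
have QP : P - Q = Q *m P.
  have -> : Q *m P = Q *m (B - (B - 1%:M)) *m P by rewrite opprB addrC subrK mulmx1.
  by rewrite mulmxBr mulmxBl mulVmx// mul1mx -mulmxA mulmxV// mulmx1.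
pose D := \tr P - \tr Q.
have DE : D = \tr (P *m Q) by rewrite -PQ linearB.
have D0 : 0 <= D by rewrite DE; exact: trace_pd_mul pP (pd_psd _ pQ).
have E1 : \tr (P *m P) - D = \tr (P *m Q *m P).
  by rewrite DE -linearB /= -mulmxBr QP mulmxA.
have E2 : 2 * D ^+ 2 <= \tr (P *m Q *m P).
  (* Cauchy-Schwarz in expanded form: [2 D] is the optimal multiple of the
     identity to subtract when [\tr Q] is replaced by its bound 1/2. *)
  pose X := P - (2 * D)%:M.
  have sX : X^T = X by rewrite linearB /= tr_scalar_mx (proj1 pP).
  have : 0 <= \tr (X *m Q *m X).
    apply: psd_trace_ge0; split=> [|u]; first by rewrite !trmx_mul sX (proj1 pQ) mulmxA.
    by rewrite -[X in _ *m X]sX form_conj; apply: (proj2 (pd_psd _ pQ)).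
  have -> : \tr (X *m Q *m X)
     = \tr (P *m Q *m P) - 2 * (2 * D) * D + (2 * D) ^+ 2 * \tr Q.
    have -> : X *m Q *m X = P *m Q *m P - (2 * D) *: (P *m Q)
        - ((2 * D) *: (Q *m P) - (2 * D) ^+ 2 *: Q).
      rewrite /X mulmxBr !mulmxBl !mul_scalar_mx !mul_mx_scalar -!scalemxAl.
      rewrite scalerA -expr2 !opprB -!addrA; congr (_ + _).
      by rewrite addrCA [RHS]addrCA; congr (_ + _); rewrite addrC.
    set z := (X in _ = X); rewrite !linearB /= !linearZ /= [\tr (Q *m P)]mxtrace_mulC.
    rewrite -DE /z /GRing.scale /=; ring.
  have : (2 * D) ^+ 2 * \tr Q <= (2 * D) ^+ 2 * (1 / 2).
    by apply: ler_wpM2l => //; exact: sqr_ge0.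
  lra.
have [j] := H (P *m P - D *: P).
rewrite linearB /= linearZ /= formBm formZm => Hj.
exists j; split.
  by apply: pdD => //; apply: psdZ => //; exact: psd_rank1.
rewrite trace_sherman_morrison// -/P.
set q2 := form (P *m P) _ _ in Hj *; set q := form P _ _ in Hj *.
have q0 : 0 <= q by exact: (proj2 (pd_psd _ pP)).
have p0 : 0 < 1 + 2 * q by rewrite ltr_pwDl// mulr_ge0.
apply: (le_trans _ tB); rewrite lerBlDr -lerBlDl -/D.
rewrite ler_pdivlMr//.
rewrite -/Q in tB.
have : D * \tr P <= D * (1 / 2 + D).
  by apply: ler_wpM2l => //; rewrite /D; lra.
by move: Hj E2 E1 (sqr_ge0 D); rewrite /GRing.scale /= => *; lra.
Qed.

End barrier.

(** The barrier starts at [- 2 n], where the potential of the empty selection is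
    exactly 1/2, and moves by 1 with each selected index. *)
Lemma isotropic_subsampling {R : realType} {n : nat} (J : Type)
    (v : J -> 'rV[R]_n) (k : nat) :
  (0 < n)%N -> (forall M, exists j, \tr M <= form M (v j) (v j)) ->
  exists j : 'I_k -> J, forall a,
    (k%:R - 2 * n%:R) * form 1%:M a a <= 2 * \sum_i form 1%:M (v (j i)) a ^+ 2.
Proof.
move=> n0 H.
pose Bk k (j : 'I_k -> J) : 'M[R]_n :=
  (2 * n%:R - k%:R)%:M + 2 *: \sum_i ((v (j i))^T *m v (j i)).
suff [j [pj _]] : exists j : 'I_k -> J, pd (Bk k j) /\ \tr (invmx (Bk k j)) <= 1 / 2.
  exists j => a; have := proj2 (pd_psd _ pj) a.
  rewrite /Bk formDm formZm form_sum -[_%:M in X in X -> _]scalemx1 formZm.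
  under eq_bigr => i _ do rewrite form_rank1.
  lra.
elim: k => [|k [j [pj tj]]].
  exists (fun i : 'I_0 => match i with Ordinal _ h => match notF h with end end).
  rewrite /Bk big_ord0 scaler0 addr0 subr0.
  have n2 : 0 < 2 * n%:R :> R by rewrite mulr_gt0// ltr0n.
  rewrite invmx_scalar -[(2 * n%:R)%:M]scalemx1; split.
    split=> [|u u0]; first by rewrite linearZ /= trmx1.
    by rewrite formZm mulr_gt0// form1_gt0.
  rewrite mxtrace_scalar -[leLHS]mulr_natr invfM -mulrA mulVf ?mulr1 ?div1r//.
  by rewrite pnatr_eq0 -lt0n.
have [i [p1 t1]] := barrier_step J v _ H pj tj.
exists (fun l : 'I_k.+1 => if unlift ord0 l is Some l' then j l' else i).
set j' := fun l : 'I_k.+1 => _.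
suff -> : Bk k.+1 j' = Bk k j - 1%:M + 2 *: ((v i)^T *m v i) by [].
rewrite /Bk big_ord_recl {1 2}/j' unlift_none.
under eq_bigr => l _ do rewrite /j' liftK.
have -> : k.+1%:R = k%:R + 1 :> R by rewrite natr1.
rewrite opprD addrA raddfB /= scalerDr.
by rewrite [2 *: _ + 2 *: _]addrC addrA; congr (_ + _); rewrite addrAC.
Qed.

(** Reduction to [G = 1] by the change of variables [v |-> v S^-1], [G = S^T S].
    After [4 n] steps the barrier has passed from [- 2 n] to [2 n], while each
    index was added with weight 2. *)
Lemma subsampling {R : realType} {n : nat} (J : Type) (v : J -> 'rV[R]_n)
    (G : 'M[R]_n) :
  (0 < n)%N -> pd G ->
  (forall M, exists j, \tr (M *m G) <= form M (v j) (v j)) ->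
  exists j : 'I_(4 * n) -> J, forall a,
    n%:R * form G a a <= \sum_i form 1%:M (v (j i)) a ^+ 2.
Proof.
move=> n0 pG H; have [S GE] := cholesky _ pG.
have uS : S \in unitmx by have := pd_unit pG; rewrite GE unitmx_mul => /andP[].
have [M|j Hj] := @isotropic_subsampling R n J (fun j => v j *m invmx S) (4 * n)%N n0.
  have [j Hj] := H (invmx S *m M *m (invmx S)^T); exists j.
  rewrite -form_conj; apply: le_trans Hj; rewrite GE.
  rewrite -!mulmxA [(invmx S)^T *m _]mulmxA -trmx_mul mulmxV// trmx1 mul1mx.
  by rewrite mxtrace_mulC -mulmxA mulmxV// mulmx1.
exists j => a; have := Hj (a *m S^T).
have -> : form 1%:M (a *m S^T) (a *m S^T) = form G a a.
  by rewrite GE /form mulmx1 trmx_mul trmxK !mulmxA.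
under eq_bigr => i _.
  have -> : form 1%:M (v (j i) *m invmx S) (a *m S^T) = form 1%:M (v (j i)) a.
    by rewrite /form !mulmx1 trmx_mul trmxK mulmxA mulmxKV.
  over.
rewrite natrM; lra.
Qed.

(** * Near-optimal determinants control all functionals *)

Section exchange.
Context {R : realType} {n : nat} {J : Type} (v : J -> 'rV[R]_n).

Definition gram {k} (j : 'I_k -> J) : 'M[R]_n :=
  \sum_i ((v (j i))^T *m v (j i)).

Lemma gram_psd k (j : 'I_k -> J) : psd (gram j).
Proof. by apply: psd_sum => i _; exact: psd_rank1. Qed.

(** By a Cholesky factorization the determinant is a square. *)
Lemma pd_det_gt0 (M : 'M[R]_n) : pd M -> 0 < \det M.
Proof.
move=> pM; have [S ME] := cholesky _ pM; have := pd_unit pM.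
by rewrite unitmxE unitfE ME det_mulmx det_tr -expr2 lt_neqAle sqr_ge0 eq_sym => ->.
Qed.

(** As long as the chosen vectors are fewer than [n], some nonzero [a] is orthogonal
    to all of them; a vector of the family not orthogonal to [a] extends the
    selection. *)
Lemma exists_spanning_family :
  (forall a, (forall j, form 1%:M (v j) a = 0) -> a = 0) ->
  exists j : 'I_n -> J, pd (gram j).
Proof.
move=> span.
suff [j jf] : exists j : 'I_n -> J, row_free (\matrix_i v (j i)).
  exists j; apply: (psd_unit_pd (gram_psd _ j)).
  have -> : gram j = (\matrix_i v (j i))^T *m \matrix_i v (j i).
    apply/matrixP => a b; rewrite /gram summxE mxE; apply: eq_bigr => i _.
    by rewrite mxE big_ord1 !mxE.
  by rewrite unitmx_mul unitmx_tr -row_free_unit jf.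
suff H k : (k <= n)%N -> exists j : 'I_k -> J, row_free (\matrix_i v (j i)).
  exact: H.
elim: k => [_|k IH kn].
  exists (fun i : 'I_0 => match i with Ordinal _ h => match notF h with end end).
  by rewrite /row_free [X in \rank X]flatmx0 mxrank0.
have [j jf] := IH (ltnW kn); set A := \matrix_i v (j i) in jf *.
have rA : \rank A = k by apply/eqP.
have : kermx A^T != 0.
  by rewrite -mxrank_eq0 mxrank_ker mxrank_tr rA -lt0n subn_gt0.
move=> /rowV0Pn[a /sub_kermxP aA a0].
have [i ai] : exists i, form 1%:M (v i) a != 0.
  apply: contrapT => H; move/eqP: a0; apply; apply: span => i.
  by apply/eqP; apply: contrapT => /negP ai; apply: H; exists i.
have vA : ~~ (v i <= A)%MS.
  apply: contra ai => /submxP[D vE]; rewrite vE form1C /form mulmx1 trmx_mul mulmxA aA.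
  by rewrite mul0mx mxE.
exists (fun l : 'I_k.+1 => if unlift ord0 l is Some l' then j l' else i).
have -> : \matrix_l v (if unlift ord0 l is Some l' then j l' else i)
     = col_mx (v i) A :> 'M[R]_(1 + k, n).
  apply/matrixP => l m; rewrite !mxE; case: splitP => l' ll'.
    have -> : l = ord0 by apply: val_inj; rewrite /= ll' [l']ord1.
    by rewrite unlift_none ord1.
  have -> : l = lift ord0 l' by apply: val_inj; rewrite /= ll'.
  by rewrite liftK mxE.
rewrite /row_free -(addsmxE (v i) A).
have := mxrank_adds_leqif (v i) A; rewrite rA => -[le1 _].
rewrite eqn_leq; apply/andP; split.
  exact: (leq_trans le1 (leq_add (rank_leq_row (v i)) (leqnn k))).
rewrite ltnNge; apply: contra vA => rs.
have [le2 E] := mxrank_leqif_sup (addsmxSr (v i) A).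
apply: (submx_trans (addsmxSl (v i) A)); rewrite -E eqn_leq le2 rA //.
Qed.

Lemma det_gram_bounded (K : R) k : (forall j i, `|v j 0 i| <= K) ->
  exists L, forall j : 'I_k -> J, \det (gram j) <= L.
Proof.
move=> vK; have entry (j : 'I_k -> J) a b : `|gram j a b| <= k%:R * K ^+ 2.
  rewrite /gram summxE (le_trans (ler_norm_sum _ _ _))//.
  have -> : k%:R * K ^+ 2 = \sum_(i < k) K ^+ 2.
    by rewrite sumr_const card_ord mulr_natl.
  apply: ler_sum => i _; rewrite !mxE big_ord1 !mxE normrM expr2.
  by apply: ler_pM.
exists (\sum_(s : 'S_n) \prod_(i < n) (k%:R * K ^+ 2)) => j.
rewrite (le_trans (ler_norm _))// (le_trans (ler_norm_sum _ _ _))//.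
apply: ler_sum => s _; rewrite normrM normrX normrN1 expr1n mul1r normr_prod.
by apply: ler_prod => i _; rewrite normr_ge0 entry.
Qed.

(** Exchange argument on a family of [2 n] indices whose Gram determinant is more
    than half of the supremum.  Taking [2 n] rather than [n] indices is what gives
    a bound independent of [n]: the leverages sum to [n], so one of them is at most
    1/2 and the Gram matrix [H] of the remaining indices keeps half of the
    determinant.  Adding any [v_w] to [H] multiplies the determinant by
    [1 + v_w H^-1 v_w^T], which is therefore at most 4. *)
Lemma sup_norming_indices (K : R) : (0 < n)%N -> (forall j i, `|v j 0 i| <= K) ->
  (forall a, (forall j, form 1%:M (v j) a = 0) -> a = 0) ->
  exists j : 'I_(n + n) -> J, forall i a,
    form 1%:M (v i) a ^+ 2 <= 3 * form (gram j) a a.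
Proof.
move=> n0 vK /exists_spanning_family[j0 pj0].
have [L detL] := det_gram_bounded K (n + n) vK.
pose j1 (i : 'I_(n + n)) := j0 (match fintype.split i with inl i' | inr i' => i' end).
pose S := [set \det (gram j) | j in [set: 'I_(n + n) -> J]].
have supS : has_sup S.
  split; first by exists (\det (gram j1)), j1.
  by exists L => _ [j _ <-].
have S0 : 0 < sup S.
  have p1 : pd (gram j1).
    rewrite /gram big_split_ord /=.
    under eq_bigr => i _ do rewrite /j1 -[lshift _ _]/(unsplit (inl i)) unsplitK.
    by apply: pdD pj0 _; apply: psd_sum => i _; exact: psd_rank1.
  apply: (lt_le_trans (pd_det_gt0 _ p1)); apply: (ub_le_sup (proj2 supS)).
  by exists j1.
have [|_ [j _ <-] dj] := @sup_adherent _ S (sup S / 2) _ supS; first by rewrite divr_gt0.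
set G := gram j in dj.
have dG : 0 < \det G by apply: lt_trans dj; rewrite subr_gt0 ltr_pdivrMr// ltr_pMr// ltr1n.
have uG : G \in unitmx by rewrite unitmxE unitfE gt_eqF.
have pG := psd_unit_pd (gram_psd _ j) uG.
pose lev i := form (invmx G) (v (j i)) (v (j i)).
(* The leverages sum to the trace of the identity. *)
have sl : \sum_i (lev i - 1 / 2) = 0.
  rewrite sumrB sumr_const card_ord.
  under eq_bigr => i _ do rewrite /lev form_trace.
  rewrite -raddf_sum /= -mulmx_sumr -/(gram j) -/G mulVmx// mxtrace1.
  by rewrite -[X in _ - X]mulr_natr natrD; field.
have [i li] : exists i, lev i <= 1 / 2.
  apply: contrapT => H.
  have Hi i : 1 / 2 < lev i by rewrite ltNge; apply/negP => h; apply: H; exists i.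
  move/eqP : sl; rewrite psumr_eq0; last by move=> i _; rewrite subr_ge0 ltW.
  move=> /allP/(_ (lshift n (Ordinal n0)) (mem_index_enum _)) /eqP H0.
  by have := Hi (lshift n (Ordinal n0)); rewrite -subr_gt0 H0 ltxx.
pose H := \sum_(l | l != i) ((v (j l))^T *m v (j l)).
have GH : G = H + (v (j i))^T *m v (j i) by rewrite /G /gram (bigD1 i)//= addrC.
have psdH : psd H by apply: psd_sum => l _; exact: psd_rank1.
have dH : \det G <= 2 * \det H.
  have -> : H = G + (- v (j i))^T *m v (j i) by rewrite linearN /= mulNmx GH addrK.
  rewrite det_rank1// -scaleN1r formZr -/(lev i).
  by have := ler_pM2l dG (lev i) (1 / 2); rewrite li; lra.
have dH0 : 0 < \det H by lra.
have uH : H \in unitmx by rewrite unitmxE unitfE gt_eqF.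
have pH := psd_unit_pd psdH uH.
exists j => w a; rewrite form1C.
have levw : form (invmx H) (v w) (v w) <= 3.
  have : \det (H + (v w)^T *m v w) <= 4 * \det H.
    pose j' l := if l == i then w else j l.
    have -> : H + (v w)^T *m v w = gram j'.
      rewrite /gram (bigD1 i)//= {1 2}/j' eqxx addrC; congr (_ + _).
      by apply: eq_bigr => l li'; rewrite /j' (negbTE li').
    have : \det (gram j') <= sup S by apply: (ub_le_sup (proj2 supS)); exists j'.
    by lra.
  rewrite det_rank1// [leRHS]mulrC ler_pM2l//; lra.
apply: (le_trans (dual_cauchy_schwarz _ _ pH)).
have : form H a a <= form G a a by rewrite GH formDm form_rank1 lerDl sqr_ge0.
have := proj2 psdH a; have := proj2 (pd_psd _ (pd_inv pH)) (v w).
nra.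
Qed.

End exchange.

(** * Continuity and measurability *)

Section continuous_complex.
Context {R : realType} {X : topologicalType} (D : set X).
Implicit Types f g : X -> Cplx R.

Definition sqnorm (z : R[i]) : R := complex.Re z ^+ 2 + complex.Im z ^+ 2.

Lemma sqnorm_ge0 z : 0 <= sqnorm z.
Proof. by rewrite addr_ge0// sqr_ge0. Qed.

Lemma normcE_sqrt z : Normc.normc z = Num.sqrt (sqnorm z).
Proof. by case: z. Qed.

Lemma normc_ge0 (z : R[i]) : 0 <= Normc.normc z.
Proof. by rewrite normcE_sqrt sqrtr_ge0. Qed.

Lemma normc_sqr z : Normc.normc z ^+ 2 = sqnorm z.
Proof. by rewrite normcE_sqrt sqr_sqrtr// sqnorm_ge0. Qed.

(** A real part is 1-Lipschitz for the norm of the regular module, whose balls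
    have radii in [R[i]]. *)
Lemma continuous_real_part (h : R[i] -> R) :
  (forall x y : R[i], h (x - y) = h x - h y) ->
  (forall z : R[i], (`|h z|%:C <= `|z|)%C) ->
  continuous (h : Cplx R -> R).
Proof.
move=> hB hz z A [e /= e0 eA]; exists (e%:C)%C; first by rewrite /= ltcR.
move=> w zw; apply: eA; rewrite /ball_ /= -hB -ltcR.
exact: (le_lt_trans (hz _) zw).
Qed.

Lemma continuous_Re : continuous (@complex.Re R : Cplx R -> R).
Proof.
apply: continuous_real_part; first by move=> x y; rewrite raddfB.
exact: normc_ge_Re.
Qed.

Lemma continuous_Im : continuous (@complex.Im R : Cplx R -> R).
Proof.
apply: continuous_real_part; first by move=> x y; rewrite raddfB.
(* [Im z] is minus the real part of [i z]. *)
move=> z; have := normc_ge_Re (z * 'i%C); rewrite ReiNIm normrN normrM.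
by rewrite [`|'i%C|]normc_def /= expr0n /= expr1n add0r sqrtr1 mulr1.
Qed.

Lemma within_continuous_Re f : {within D, continuous f} ->
  {within D, continuous (fun x => complex.Re (f x) : R)}.
Proof. by apply: within_continuous_comp => z _; exact: continuous_Re. Qed.

Lemma within_continuous_Im f : {within D, continuous f} ->
  {within D, continuous (fun x => complex.Im (f x) : R)}.
Proof. by apply: within_continuous_comp => z _; exact: continuous_Im. Qed.

Lemma within_continuousM (f g : X -> R) : {within D, continuous f} ->
  {within D, continuous g} -> {within D, continuous (fun x => f x * g x)}.
Proof. by move=> cf cg x; apply: cvgM; [exact: cf|exact: cg]. Qed.

Lemma within_continuousZ (a : R[i]) f : {within D, continuous f} ->
  {within D, continuous (fun x => a * f x : Cplx R)}.
Proof. by move=> cf x; apply: cvgMr; exact: cf. Qed.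

Lemma within_continuous_sum (I : Type) (r : seq I) (h : I -> X -> Cplx R) :
  (forall i, {within D, continuous (h i)}) ->
  {within D, continuous (fun x => \sum_(i <- r) h i x : Cplx R)}.
Proof.
move=> ch; elim: r => [|i r IH].
  rewrite (_ : (fun _ => _) = cst 0); first by move=> x; exact: cvg_cst.
  by apply/funext => x; rewrite big_nil.
rewrite (_ : (fun _ => _) = h i + (fun x => \sum_(i <- r) h i x : Cplx R)).
  by move=> x; apply: cvgD; [exact: ch|exact: IH].
by apply/funext => x; rewrite big_cons.
Qed.

Lemma within_continuous_sqnorm f : {within D, continuous f} ->
  {within D, continuous (fun x => sqnorm (f x))}.
Proof.
move=> cf; apply: (@within_continuousD _ _ _ D
   (fun x => complex.Re (f x) ^+ 2 : R) (fun x => complex.Im (f x) ^+ 2 : R)).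
- rewrite (_ : (fun _ => _) = (fun x => complex.Re (f x) * complex.Re (f x))).
    by apply: within_continuousM; exact: within_continuous_Re.
  by apply/funext => x; rewrite expr2.
- rewrite (_ : (fun _ => _) = (fun x => complex.Im (f x) * complex.Im (f x))).
    by apply: within_continuousM; exact: within_continuous_Im.
  by apply/funext => x; rewrite expr2.
Qed.

Lemma compact_bounded_fun (g : X -> R) : compact D ->
  {within D, continuous g} -> exists2 K, 0 <= K & forall x, D x -> `|g x| <= K.
Proof.
move=> cD cg; have [->|/set0P D0] := eqVneq D set0; first by exists 0.
have [c _ cM] := compact_EVT_max D0 cD cg.
have [c' _ cm] := compact_EVT_min D0 cD cg.
exists (`|g c| + `|g c'|); first by rewrite addr_ge0.
move=> x Dx; have xD : x \in D by rewrite inE.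
have := cM _ xD; have := cm _ xD.
have := ler_norm (g c); have := ler_norm (- g c'); rewrite normrN.
have := normr_ge0 (g c); have := normr_ge0 (g c').
by rewrite ler_norml => *; apply/andP; split; lra.
Qed.

End continuous_complex.

Section borel_measurability.
Context {R : realType} {d : nat} (Omega : set 'rV[R]_d).
Hypothesis cOmega : compact Omega.
Let X := borel 'rV[R]_d.

Lemma compact_measurable : measurable (Omega : set X).
Proof.
rewrite -(setCK Omega); apply: measurableC; apply: sub_sigma_algebra.
by rewrite /= openC; apply: compact_closed => //; exact: norm_hausdorff.
Qed.

Lemma within_preimage_measurable (U : topologicalType) (f : 'rV[R]_d -> U) (A : set U) :
  {within Omega, continuous f} -> open A ->
  measurable (Omega `&` f @^-1` A : set X).
Proof.
move=> /continuousP cf /cf /open_subspaceP [V oV VE].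
rewrite setIC -VE; apply: measurableI; last exact: compact_measurable.
exact: sub_sigma_algebra.
Qed.

Lemma within_continuous_measurable (f : 'rV[R]_d -> R) :
  {within Omega, continuous f} -> measurable_fun (Omega : set X) (f : X -> R).
Proof.
move=> cf; apply: (measurability _ (RGenOInfty.measurableE R)).
move=> _ [_ [x ->] <-]; apply: within_preimage_measurable => //.
Qed.

Lemma within_continuous_borel_measurable (f : 'rV[R]_d -> Cplx R) :
  {within Omega, continuous f} ->
  measurable_fun (Omega : set X) (f : X -> borel (Cplx R)).
Proof.
move=> cf; apply: (@measurability _ _ X (borel (Cplx R)) Omega f (@open (Cplx R)) erefl).
by move=> _ [A oA <-]; exact: within_preimage_measurable.
Qed.

Variable mu : probability X R.

Lemma within_continuous_integrable (f : 'rV[R]_d -> R) :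
  {within Omega, continuous f} -> mu.-integrable (Omega : set X) (EFin \o f).
Proof.
move=> cf; have [K K0 fK] := compact_bounded_fun Omega f cOmega cf.
apply: measurable_bounded_integrable.
- exact: compact_measurable.
- exact: (le_lt_trans (probability_le1 mu compact_measurable) (ltry 1)).
- exact: within_continuous_measurable.
- exists K; split; first exact: num_real.
  by move=> L KL x /fK /le_trans; apply; exact: ltW.
Qed.

End borel_measurability.

(** * Subsampling for a measure and two real functionals *)

Section averaging.
Context {R : realType} {d : nat} (Omega : set 'rV[R]_d).
Hypothesis cOmega : compact Omega.
Variable mu : probability (borel 'rV[R]_d) R.

Lemma Rintegral_sum (I : Type) (r : seq I) (h : I -> 'rV[R]_d -> R) :
  (forall i, mu.-integrable Omega (EFin \o h i)) ->
  \int[mu]_(x in Omega) (\sum_(i <- r) h i x) =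
  \sum_(i <- r) \int[mu]_(x in Omega) h i x
  /\ mu.-integrable Omega (EFin \o (fun x => \sum_(i <- r) h i x)).
Proof.
move=> ih; have mO := compact_measurable Omega cOmega.
have int s : mu.-integrable Omega (EFin \o (fun x => \sum_(i <- s) h i x)).
  rewrite (_ : _ \o _ = fun x => (\sum_(i <- s) (EFin \o h i) x)%E).
    by apply: (integrable_sum mO).
  by apply/funext => x /=; rewrite sumEFin.
split=> //; elim: r => [|i r IH].
  rewrite big_nil; under eq_Rintegral do rewrite big_nil.
  by rewrite Rintegral_cst// mul0r.
rewrite big_cons -IH -RintegralD//.
by apply: eq_Rintegral => x _; rewrite big_cons.
Qed.

Context {n : nat} (V : 'rV[R]_d -> 'rV[R]_n).
Hypothesis cV : forall i, {within Omega, continuous (fun x => V x 0 i)}.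

Definition gram_integral : 'M[R]_n :=
  \matrix_(k, l) \int[mu]_(x in Omega) (V x 0 k * V x 0 l).

Lemma form_expand (M : 'M[R]_n) (u : 'rV[R]_n) :
  form M u u = \sum_k \sum_l M k l * (u 0 l * u 0 k).
Proof.
rewrite form_trace /mxtrace; apply: eq_bigr => k _; rewrite mxE.
by apply: eq_bigr => l _; rewrite !mxE big_ord1 !mxE.
Qed.

(** All integrals of quadratic expressions in [V] reduce to this one; the case
    [M = a^T a] gives the integral of a squared functional. *)
Lemma trace_gram_integral (M : 'M[R]_n) :
  \tr (M *m gram_integral) = \int[mu]_(x in Omega) form M (V x) (V x)
  /\ mu.-integrable Omega (EFin \o (fun x => form M (V x) (V x))).
Proof.
have mO := compact_measurable Omega cOmega.
have i1 k l : mu.-integrable Omega (EFin \o (fun x => V x 0 l * V x 0 k)).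
  by apply: within_continuous_integrable => //; exact: within_continuousM.
have i2 k l : mu.-integrable Omega (EFin \o (fun x => M k l * (V x 0 l * V x 0 k))).
  exact: (integrableZl mO (M k l) (i1 k l)).
have i3 k := Rintegral_sum _ (index_enum _) _ (i2 k).
have [E4 i4] := Rintegral_sum _ (index_enum _) _ (fun k => proj2 (i3 k)).
have fE : (fun x => form M (V x) (V x)) =
  (fun x => \sum_k \sum_l M k l * (V x 0 l * V x 0 k)).
  by apply/funext => x; exact: form_expand.
split; last by rewrite fE.
rewrite fE E4 /mxtrace; apply: eq_bigr => k _; rewrite mxE (proj1 (i3 k)).
by apply: eq_bigr => l _; rewrite RintegralZl// mxE.
Qed.

Lemma gram_integral_psd : psd gram_integral.
Proof.
split.
  apply/matrixP => k l; rewrite !mxE; apply: eq_Rintegral => x _; exact: mulrC.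
move=> a; rewrite form_trace mxtrace_mulC (proj1 (trace_gram_integral _)).
by apply: Rintegral_ge0 => x _; rewrite form_rank1 sqr_ge0.
Qed.

End averaging.

Section mixture.
Context {R : realType} {d : nat} (Omega : set 'rV[R]_d).
Hypothesis cOmega : compact Omega.
Variable mu : probability (borel 'rV[R]_d) R.
Hypothesis muOmega : mu Omega = 1%E.

Context {n : nat} (V W : 'rV[R]_d -> 'rV[R]_n).
Hypothesis cV : forall i, {within Omega, continuous (fun x => V x 0 i)}.
Hypothesis cW : forall i, {within Omega, continuous (fun x => W x 0 i)}.

Let J := ({x | Omega x} * bool)%type.
Let v (j : J) : 'rV[R]_n := if j.2 then V (sval j.1) else W (sval j.1).

(** The mean of [v^T v] for a probability measure on the indices: mu has one half
    of the weight, shared by [V] and [W], and the [2 n] members of the family [j]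
    share the other half. *)
Definition mixed_gram (j : 'I_(n + n) -> J) : 'M[R]_n :=
  (1 / 4) *: (gram_integral Omega mu V + gram_integral Omega mu W)
  + (4 * n%:R)^-1 *: gram v j.

(** Some index is at least as large as an average.  The contradiction needs a
    strict inequality, which comes from the finite half of the average, so that
    nothing strict has to be integrated. *)
Lemma exists_above_average (j : 'I_(n + n) -> J) (M : 'M[R]_n) : (0 < n)%N ->
  exists i, \tr (M *m mixed_gram j) <= form M (v i) (v i).
Proof.
move=> n0; apply: contrapT => H; set t := \tr _ in H.
have {}H i : form M (v i) (v i) < t.
  by rewrite ltNge; apply/negP => h; apply: H; exists i.
have mO := compact_measurable Omega cOmega.
have int (U : 'rV[R]_d -> 'rV[R]_n) (cU : forall i, {within Omega, continuous (fun x => U x 0 i)}) :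
    (forall x, Omega x -> form M (U x) (U x) < t) ->
    \tr (M *m gram_integral Omega mu U) <= t.
  move=> Ut; have [-> iU] := trace_gram_integral Omega cOmega mu U cU M.
  have -> : t = \int[mu]_(x in Omega) t.
    rewrite Rintegral_cst//; transitivity (t * fine 1%E); first by rewrite mulr1.
    by congr (_ * fine _); exact: esym.
  apply: le_Rintegral => //; last by move=> x /Ut/ltW.
  apply: within_continuous_integrable => // x; exact: cvg_cst.
have iV := int V cV (fun x Ox => H (exist _ x Ox, true)).
have iW := int W cW (fun x Ox => H (exist _ x Ox, false)).
have lg : \tr (M *m gram v j) < t *+ (n + n).
  rewrite mulmx_sumr raddf_sum /=.
  under eq_bigr => i _ do rewrite -form_trace.
  have -> : t *+ (n + n) = \sum_(i < n + n) t by rewrite sumr_const card_ord.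
  rewrite (bigD1 (lshift n (Ordinal n0)))//= [ltRHS](bigD1 (lshift n (Ordinal n0)))//=.
  by rewrite ltr_leD//; apply: ler_sum => i _; exact: ltW.
have : t = 1 / 4 * (\tr (M *m gram_integral Omega mu V)
      + \tr (M *m gram_integral Omega mu W)) + (4 * n%:R)^-1 * \tr (M *m gram v j).
  rewrite /t /mixed_gram mulmxDr -!scalemxAr mulmxDr.
  by rewrite mxtraceD !mxtraceZ mxtraceD.
have n4 : 0 < (4 * n%:R : R)^-1 by rewrite invr_gt0 mulr_gt0// ltr0n.
have : (4 * n%:R)^-1 * \tr (M *m gram v j) < t / 2.
  rewrite -(ltr_pM2l n4) in lg; apply: (lt_le_trans lg).
  rewrite -[t *+ _]mulr_natr natrD le_eqVlt; apply/orP; left; apply/eqP; field.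
  by rewrite pnatr_eq0 -lt0n.
lra.
Qed.

(** The family of [sup_norming_indices] enters the averaged Gram matrix with half
    of the weight.  This makes the matrix positive definite even when mu does not
    see all of the span, and it carries the uniform norm through the
    subsampling: a bound by the Gram form of that family becomes a bound by the
    sampled sum of squares. *)
Lemma exists_sampling_indices : (0 < n)%N ->
  (forall a, (forall x, Omega x ->
     form 1%:M (V x) a = 0 /\ form 1%:M (W x) a = 0) -> a = 0) ->
  exists x : 'I_(4 * n) -> 'rV[R]_d, (forall i, Omega (x i)) /\ forall a,
    let s x := form 1%:M (V x) a ^+ 2 + form 1%:M (W x) a ^+ 2 in
    n%:R * \int[mu]_(x in Omega) s x <= 4 * \sum_i s (x i)
    /\ forall y, Omega y -> s y <= 24 * \sum_i s (x i).
Proof.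
move=> n0 span.
have bdd (U : 'rV[R]_d -> 'rV[R]_n) (cU : forall i, {within Omega, continuous (fun x => U x 0 i)}) :
    exists K : R, forall x (i : 'I_n), Omega x -> `|U x 0 i| <= K.
  have /choice[K HK] : forall i, exists K : R, 0 <= K /\ forall x, Omega x -> `|U x 0 i| <= K.
    by move=> i; have [K K0 HK] := compact_bounded_fun Omega _ cOmega (cU i); exists K.
  exists (\sum_i K i) => x i Ox; apply: (le_trans (proj2 (HK i) x Ox)).
  by rewrite (bigD1 i)//= lerDl sumr_ge0// => l _; exact: (proj1 (HK l)).
have [K1 HK1] := bdd V cV; have [K2 HK2] := bdd W cW.
have [||j Hj] := @sup_norming_indices R n J v (Num.max K1 K2) n0.
- by move=> [[x Ox] []] i; rewrite /v /= le_max ?HK1 ?HK2 ?orbT.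
- by move=> a Ha; apply: span => x Ox; split;
    [exact: (Ha (exist _ x Ox, true))|exact: (Ha (exist _ x Ox, false))].
have n4 : 0 < (4 * n%:R : R)^-1 by rewrite invr_gt0 mulr_gt0// ltr0n.
have psdI : psd ((1 / 4) *: (gram_integral Omega mu V + gram_integral Omega mu W)).
  by apply: psdZ => //; apply: psdD; exact: gram_integral_psd.
have psdg := gram_psd v _ j.
have pG : pd (mixed_gram j).
  rewrite /mixed_gram addrC; apply: pdD => //.
  split; first by rewrite linearZ /= (proj1 psdg).
  move=> a a0; rewrite formZm mulr_gt0// lt_neqAle (proj2 psdg) andbT eq_sym.
  apply: contra a0 => /eqP a0; apply/eqP; apply: span => x Ox.
  have H i : form 1%:M (v i) a = 0.
    by apply/eqP; rewrite -sqrf_eq0 eq_le sqr_ge0 andbT (le_trans (Hj i a))// a0 mulr0.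
  by split; [exact: (H (exist _ x Ox, true))|exact: (H (exist _ x Ox, false))].
have [i Hi] := subsampling _ v _ n0 pG (fun M => exists_above_average j M n0).
exists (fun l => sval (i l).1); split; first by move=> l; case: (i l) => -[].
move=> a s.
(* A selected index contributes one of the two squares at its point; the other
   one can only help. *)
have le1 : n%:R * form (mixed_gram j) a a <= \sum_l s (sval (i l).1).
  apply: (le_trans (Hi a)); apply: ler_sum => l _; rewrite /s /v.
  by case: (i l).2; rewrite ?lerDl ?lerDr sqr_ge0.
have formI (U : 'rV[R]_d -> 'rV[R]_n) (cU : forall i, {within Omega, continuous (fun x => U x 0 i)}) :
   form (gram_integral Omega mu U) a a = \int[mu]_(x in Omega) (form 1%:M (U x) a ^+ 2)
   /\ mu.-integrable Omega (EFin \o (fun x => form 1%:M (U x) a ^+ 2)).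
  have [E I] := trace_gram_integral Omega cOmega mu U cU (a^T *m a).
  have fE : (fun x => form (a^T *m a) (U x) (U x)) = (fun x => form 1%:M (U x) a ^+ 2).
    by apply/funext => x; rewrite form_rank1 form1C.
  by rewrite fE in E I; rewrite form_trace mxtrace_mulC E.
have [EV IV] := formI V cV; have [EW IW] := formI W cW.
have mE : form (mixed_gram j) a a = 1 / 4 * \int[mu]_(x in Omega) s x
    + (4 * n%:R)^-1 * form (gram v j) a a.
  rewrite /mixed_gram formDm !formZm formDm EV EW RintegralD//.
  exact: compact_measurable.
have nI : 0 <= \int[mu]_(x in Omega) s x.
  by apply: Rintegral_ge0 => x _; rewrite addr_ge0// sqr_ge0.
have ng := proj2 psdg a.
have nn : n%:R * (4 * n%:R)^-1 = 1 / 4 :> R.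
  by field; rewrite pnatr_eq0 -lt0n.
rewrite mE mulrDr [X in _ + X]mulrA nn in le1.
have n1 : 0 <= n%:R * \int[mu]_(x in Omega) s x by rewrite mulr_ge0.
split; first by lra.
move=> y Oy; have := Hj (exist _ y Oy, true) a; have := Hj (exist _ y Oy, false) a.
rewrite /v /= /s; lra.
Qed.

End mixture.

(** * Least squares in a complex space of functions *)

Section least_squares.
Context {R : realType}.
Local Notation C := R[i].

Definition adjoint {m n} (M : 'M[C]_(m, n)) : 'M[C]_(n, m) :=
  (map_mx (@conjc R) M)^T.

Lemma adjointM m n p (M : 'M[C]_(m, n)) (Q : 'M[C]_(n, p)) :
  adjoint (M *m Q) = adjoint Q *m adjoint M.
Proof. by rewrite /adjoint map_mxM trmx_mul. Qed.

Lemma adjointK m n (M : 'M[C]_(m, n)) : adjoint (adjoint M) = M.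
Proof. by apply/matrixP => i j; rewrite !mxE conjcK. Qed.

Lemma sqnormE (z : C) : (sqnorm z)%:C = z * (z^*)%C.
Proof. by rewrite -sqr_normc -add_Re2_Im2. Qed.

Lemma adjoint_sqnorm m (y : 'rV[C]_m) :
  (y *m adjoint y) 0 0 = (\sum_l sqnorm (y 0 l))%:C.
Proof.
rewrite mxE rmorph_sum; apply: eq_bigr => l _.
by rewrite !mxE; exact: esym (sqnormE _).
Qed.

Lemma pythagoras m (w r : 'rV[C]_m) : r *m adjoint w = 0 ->
  \sum_l sqnorm (w 0 l) <= \sum_l sqnorm ((w + r) 0 l).
Proof.
move=> rw; have wr : w *m adjoint r = 0.
  by rewrite -[LHS]adjointK adjointM adjointK rw /adjoint map_mx0 trmx0.
rewrite -lecR -!adjoint_sqnorm /adjoint map_mxD linearD /= -!/(adjoint _).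
rewrite mulmxDl !mulmxDr rw wr addr0 add0r [leRHS]mxE lerDl adjoint_sqnorm.
by rewrite lecR sumr_ge0// => l _; exact: sqnorm_ge0.
Qed.

(** The right inverse [adjoint B *m invmx (B *m adjoint B)] of [B]: with it,
    [z L B] is the orthogonal projection of [z] on the row space of [B], hence no
    longer than [z]. *)
Lemma least_squares N m (B : 'M[C]_(N, m)) :
  (forall a : 'rV[C]_N, a *m B = 0 -> a = 0) ->
  exists L : 'M[C]_(m, N), B *m L = 1%:M /\ forall z : 'rV[C]_m,
    \sum_l sqnorm ((z *m L *m B) 0 l) <= \sum_l sqnorm (z 0 l).
Proof.
move=> freeB; have uB : B *m adjoint B \in unitmx.
  rewrite -row_free_unit -kermx_eq0; apply/negPn/negP => /rowV0Pn[a].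
  move=> /sub_kermxP aB /negP; apply; apply/eqP; apply: freeB.
  have : (a *m B *m adjoint (a *m B)) 0 0 = 0.
    by rewrite adjointM mulmxA -[a *m B *m _]mulmxA aB mul0mx mxE.
  rewrite adjoint_sqnorm => -[] /eqP; rewrite psumr_eq0; last first.
    by move=> l _; exact: sqnorm_ge0.
  move=> /allP H; apply/rowP => l; have := H l (mem_index_enum _).
  move=> /eqP; rewrite -normc_sqr => /eqP; rewrite sqrf_eq0 => /eqP/Normc.eq0_normc ->.
  by rewrite mxE.
pose L := adjoint B *m invmx (B *m adjoint B).
exists L; split; first by rewrite /L mulmxA mulmxV.
move=> z; have {2}-> : z = z *m L *m B + (z - z *m L *m B) by rewrite addrC subrK.
apply: pythagoras; rewrite adjointM mulmxA mulmxBl.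
have -> : z *m L *m B *m adjoint B = z *m adjoint B.
  by rewrite /L -!mulmxA [invmx _ *m _]mulVmx// mulmx1.
by rewrite subrr mul0mx.
Qed.

End least_squares.

Section complex_span.
Context {R : realType} {d : nat} (Omega : set 'rV[R]_d).
Hypothesis cOmega : compact Omega.
Variable mu : probability (borel 'rV[R]_d) R.
Hypothesis muOmega : mu Omega = 1%E.
Context {N : nat} (b : 'I_N -> 'rV[R]_d -> Cplx R).
Hypothesis N0 : (0 < N)%N.
Hypothesis cb : forall i, {within Omega, continuous (b i)}.
Hypothesis freeb : forall a : 'I_N -> R[i],
  (forall t, Omega t -> \sum_i a i * b i t = 0) -> forall i, a i = 0.

Definition lincomb (a : 'rV[R[i]]_N) (t : 'rV[R]_d) : Cplx R :=
  \sum_i a 0 i * b i t.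

Lemma lincombD a c t : lincomb (a + c) t = lincomb a t + lincomb c t.
Proof.
by rewrite /lincomb -big_split; apply: eq_bigr => i _; rewrite mxE mulrDl.
Qed.

Lemma lincombZ (k : R[i]) a t : lincomb (k *: a) t = k * lincomb a t.
Proof.
by rewrite /lincomb mulr_sumr; apply: eq_bigr => i _; rewrite mxE mulrA.
Qed.

Lemma lincombB a c t : lincomb (a - c) t = lincomb a t - lincomb c t.
Proof. by rewrite -scaleN1r lincombD lincombZ mulN1r. Qed.

Lemma within_continuous_lincomb a : {within Omega, continuous (lincomb a)}.
Proof.
by apply: within_continuous_sum => i; exact: within_continuousZ.
Qed.

(** Real coordinates for a complex span: [enc] lists the real and imaginary parts
    of the coefficients, and [V t], [W t] are the functionals which compute from
    them the real and the imaginary part of the value at [t]. *)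
Lemma exists_sampling_points :
  exists x : 'I_(4 * (N + N)) -> 'rV[R]_d, (forall i, Omega (x i)) /\ forall a,
    let s := \sum_i sqnorm (lincomb a (x i)) in
    N%:R * \int[mu]_(t in Omega) sqnorm (lincomb a t) <= 2 * s
    /\ forall t, Omega t -> sqnorm (lincomb a t) <= 24 * s.
Proof.
pose V t : 'rV[R]_(N + N) :=
  row_mx (\row_i complex.Re (b i t)) (\row_i - complex.Im (b i t)).
pose W t : 'rV[R]_(N + N) :=
  row_mx (\row_i complex.Im (b i t)) (\row_i complex.Re (b i t)).
pose enc (a : 'rV[R[i]]_N) : 'rV[R]_(N + N) :=
  row_mx (\row_i complex.Re (a 0 i)) (\row_i complex.Im (a 0 i)).
have VE a t : form 1%:M (V t) (enc a) = complex.Re (lincomb a t).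
  rewrite form1E big_split_ord /= /lincomb raddf_sum -big_split /=.
  apply: eq_bigr => i _; rewrite !row_mxEl !row_mxEr !mxE.
  by case: (a 0 i) => ? ?; case: (b i t) => ? ? /=; ring.
have WE a t : form 1%:M (W t) (enc a) = complex.Im (lincomb a t).
  rewrite form1E big_split_ord /= /lincomb raddf_sum -big_split /=.
  apply: eq_bigr => i _; rewrite !row_mxEl !row_mxEr !mxE.
  by case: (a 0 i) => ? ?; case: (b i t) => ? ? /=; ring.
have cV i : {within Omega, continuous (fun t => V t 0 i)}.
  rewrite /V; case: (split_ordP i) => k ->.
    rewrite (_ : (fun _ => _) = (fun t => complex.Re (b k t))).
      exact: within_continuous_Re.
    by apply/funext => t; rewrite row_mxEl mxE.
  rewrite (_ : (fun _ => _) = (fun t => complex.Im ((- 1) * b k t))).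
    by apply: within_continuous_Im; exact: within_continuousZ.
  by apply/funext => t; rewrite row_mxEr mxE mulN1r raddfN.
have cW i : {within Omega, continuous (fun t => W t 0 i)}.
  rewrite /W; case: (split_ordP i) => k ->.
    rewrite (_ : (fun _ => _) = (fun t => complex.Im (b k t))).
      exact: within_continuous_Im.
    by apply/funext => t; rewrite row_mxEl mxE.
  rewrite (_ : (fun _ => _) = (fun t => complex.Re (b k t))).
    exact: within_continuous_Re.
  by apply/funext => t; rewrite row_mxEr mxE.
have span r : (forall t, Omega t ->
     form 1%:M (V t) r = 0 /\ form 1%:M (W t) r = 0) -> r = 0.
  pose a := \row_i (r 0 (lshift N i) +i* r 0 (rshift N i))%C.
  have -> : r = enc a.
    apply/rowP => i; rewrite /enc; case: (split_ordP i) => k ->.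
      by rewrite row_mxEl !mxE.
    by rewrite row_mxEr !mxE.
  move=> H; have a0 : forall i, a 0 i = 0.
    apply: freeb => t /H; rewrite VE WE /lincomb => -[].
    by case: (\sum_i _) => ? ? /= -> ->.
  by apply/rowP => i; rewrite /enc; case: (split_ordP i) => k ->;
    rewrite ?row_mxEl ?row_mxEr [LHS]mxE a0 mxE.
have NN0 : (0 < N + N)%N by rewrite addn_gt0 N0.
have [x [Ox Hx]] := exists_sampling_indices Omega cOmega mu muOmega V W cV cW NN0 span.
exists x; split=> // a s; have := Hx (enc a) => /=.
have sE t : form 1%:M (V t) (enc a) ^+ 2 + form 1%:M (W t) (enc a) ^+ 2
    = sqnorm (lincomb a t) by rewrite VE WE.
under eq_Rintegral do rewrite sE.
move=> [H1 H2]; split.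
  by move: H1; under eq_bigr do rewrite sE; rewrite -/s natrD mulrDl; lra.
by move=> t Ot; have := H2 t Ot; rewrite sE; under eq_bigr do rewrite sE.
Qed.

(** The sampling points found above may repeat, whereas a sampling set consists of
    distinct points; repeated points act as weights in the least squares fit. *)
Lemma distinct_points m (x : 'I_m -> 'rV[R]_d) :
  exists k (y : 'I_k -> 'rV[R]_d) (sigma : 'I_m -> 'I_k),
    [/\ (k <= m)%N, injective y, forall l, x l = y (sigma l)
      & forall i, exists l, y i = x l].
Proof.
pose s := undup (codom x).
have xs l : x l \in s by rewrite mem_undup codom_f.
have ix l : (index (x l) s < size s)%N by rewrite index_mem.
exists (size s), (tnth (in_tuple s)), (fun l => Ordinal (ix l)); split.
- by rewrite (leq_trans (size_undup _))// size_codom card_ord.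
- by apply/tuple_uniqP; exact: undup_uniq.
- by move=> l; rewrite (tnth_nth (x l)) /= nth_index.
- move=> i; have : tnth (in_tuple s) i \in s := mem_tnth _ _.
  by rewrite mem_undup => /codomP.
Qed.

(** [coef] is the least squares fit at the sampling points.  It reproduces
    [lincomb a], so [u] is the coefficient vector of the fit of [f - lincomb a],
    whose values at the [8 N] points are at most [e]. *)
Lemma exists_sampling_operator :
  exists k (y : 'I_k -> 'rV[R]_d) (coef : 'rV[R[i]]_k -> 'rV[R[i]]_N),
  [/\ (k <= 8 * N)%N, injective y, forall i, Omega (y i),
      forall c v w, coef (c *: v + w) = c *: coef v + coef w &
      forall (f : 'rV[R]_d -> R[i]) a e, 0 <= e ->
        (forall t, Omega t -> Normc.normc (f t - lincomb a t) <= e) ->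
        let u := coef (\row_i f (y i)) - a in
        \int[mu]_(t in Omega) sqnorm (lincomb u t) <= 16 * e ^+ 2 /\
        forall t, Omega t -> sqnorm (lincomb u t) <= 192 * N%:R * e ^+ 2].
Proof.
have [x [Ox Hx]] := exists_sampling_points.
have [k [y [sigma [km yinj xy yx]]]] := distinct_points _ x.
pose B := \matrix_(i, l) (b i (x l) : R[i]).
have BE a l : (a *m B) 0 l = lincomb a (x l).
  by rewrite mxE; apply: eq_bigr => i _; rewrite mxE.
have [a aB|L [BL HL]] := least_squares _ _ B.
  have s0 : \sum_i sqnorm (lincomb a (x i)) = 0.
    rewrite big1// => l _; rewrite -BE aB mxE /sqnorm /= expr0n /= addr0 //.
  apply/rowP => i; rewrite mxE; apply: (freeb (fun i => a 0 i)) => t Ot.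
  apply: Normc.eq0_normc; rewrite -/(lincomb a t) normcE_sqrt.
  have := proj2 (Hx a) t Ot; rewrite s0 mulr0 => H.
  by apply/eqP; rewrite sqrtr_eq0.
pose coef (v : 'rV[R[i]]_k) := (\row_l v 0 (sigma l)) *m L.
exists k, y, coef; split=> //.
- by apply: (leq_trans km); rewrite addnn -muln2 [(N * 2)%N]mulnC mulnA.
- by move=> i; have [l ->] := yx i.
- move=> c v w; rewrite /coef scalemxAl -mulmxDl; congr (_ *m _).
  by apply/rowP => l; rewrite !mxE.
move=> f a e e0 fa u.
pose z := \row_l (f (x l) - lincomb a (x l)).
have uE : u = z *m L.
  rewrite /u /coef; have -> : \row_l (\row_i f (y i)) 0 (sigma l) = z + a *m B.
    by apply/rowP => l; rewrite 2!mxE [RHS]mxE BE mxE subrK xy.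
  by rewrite mulmxDl -mulmxA BL mulmx1 addrK.
have su : \sum_l sqnorm (lincomb u (x l)) <= 8 * N%:R * e ^+ 2.
  under eq_bigr do rewrite -BE uE.
  apply: (le_trans (HL z)).
  have -> : 8 * N%:R * e ^+ 2 = \sum_(l < 4 * (N + N)) e ^+ 2.
    by rewrite sumr_const card_ord -[RHS]mulr_natl natrM natrD; ring.
  apply: ler_sum => l _; rewrite mxE -normc_sqr.
  by rewrite ler_pXn2r// ?nnegrE ?normc_ge0//; exact: fa.
have [H1 H2] := Hx u; split.
  have N1 : 0 < N%:R :> R by rewrite ltr0n.
  by rewrite -(ler_pM2l N1); apply: (le_trans H1); lra.
by move=> t /H2 /le_trans; apply; lra.
Qed.

End complex_span.

(** * Orlicz norms *)

Section growth.
Context {R : realType} (Phi : R -> R) (p : R).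
Hypothesis PhiP : Phi_function Phi.
Hypothesis p2 : 2 <= p.
Hypothesis Phip : forall s t : R, 0 < s -> s <= t ->
  Phi s * s `^ (- p) <= Phi t * t `^ (- p).

Lemma Phi_ge0 t : 0 <= t -> 0 <= Phi t.
Proof. by case: PhiP => -[+ _ _] _ _ _; exact. Qed.

Lemma Phi_homo s t : 0 <= s -> s <= t -> Phi s <= Phi t.
Proof. by case: PhiP => -[_ + _] _ _ _; exact. Qed.

Lemma Phi_le_powR s t : 0 < s -> s <= t -> Phi s <= Phi t * (s / t) `^ p.
Proof.
move=> s0 st; have t0 := lt_le_trans s0 st; have := Phip s t s0 st.
rewrite !powRN => H.
have sp : 0 < s `^ p by exact: powR_gt0.
have -> : (s / t) `^ p = s `^ p / t `^ p.
  by rewrite powRM ?invr_ge0 ?ltW// -[t^-1]powR_inv1 ?ltW// -!powRrM mulN1r powRN.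
by rewrite mulrCA mulrC -ler_pdivrMr.
Qed.

(** This is where [2 <= p] matters: it turns a bound for the square integral of a
    bounded function into a bound for its modular. *)
Lemma Phi_le_sqr s t : 0 < t -> 0 <= s -> s <= t -> Phi s <= Phi t * (s / t) ^+ 2.
Proof.
move=> t0; rewrite le_eqVlt => /predU1P[<- _|s0 st].
  have -> : Phi 0 = 0 by case: PhiP => -[].
  by rewrite mulr_ge0 ?sqr_ge0// Phi_ge0// ltW.
apply: (le_trans (Phi_le_powR _ _ s0 st)); apply: ler_wpM2l; first exact: Phi_ge0 (ltW t0).
have st1 : 0 < s / t <= 1 by rewrite divr_gt0//= ler_pdivrMr// mul1r.
rewrite -powR_mulrn; first exact: (ger_powR st1 p2).
by rewrite divr_ge0 ?ltW.
Qed.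

(** [Phi t / t^2] increases, so the smallest [N] at which [Phi (sqrt N)] is positive
    gives the bound.  The bound depends on [Phi] and cannot be replaced by
    [Phi 1], which may vanish. *)
Lemma Phi_ratio_lower_bound : exists2 kappa : R, 0 < kappa &
  forall N : nat, (1 <= N)%N -> 0 < Phi (Num.sqrt N%:R) ->
    kappa <= Phi (Num.sqrt N%:R) / N%:R.
Proof.
pose P N := (1 <= N)%N && (0 < Phi (Num.sqrt N%:R)).
have [exP|nP] := pselect (exists N, P N); last first.
  by exists 1 => // N N1 PN; exfalso; apply: nP; exists N; rewrite /P N1.
case: (ex_minnP exP) => N0 /andP[N1 PN] minN.
have N00 : 0 < N0%:R :> R by rewrite ltr0n.
exists (Phi (Num.sqrt N0%:R) / N0%:R); first exact: divr_gt0.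
move=> N NN PNN; have le0 : (N0 <= N)%N by apply: minN; rewrite /P NN.
have Np : 0 < N%:R :> R by rewrite ltr0n.
rewrite ler_pdivrMr// mulrAC -mulrA.
have := Phi_le_sqr (Num.sqrt N0%:R) (Num.sqrt N%:R).
rewrite sqrtr_gt0 Np sqrtr_ge0 ler_psqrt ?nnegrE ?ler0n// ler_nat le0.
rewrite expr_div_n !sqr_sqrtr ?ler0n//; exact.
Qed.

Lemma Phi_rescaled_le N r s : 0 < N -> 1 <= s -> 0 < r ->
  r = Phi (Num.sqrt N) / N -> r <= s `^ p -> Phi (Num.sqrt N / s) <= N.
Proof.
move=> N0 s1 r0 rE rs; have s0 := lt_le_trans ltr01 s1.
have q0 : 0 < Num.sqrt N by rewrite sqrtr_gt0.
have h : Num.sqrt N / s <= Num.sqrt N.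
  by rewrite ler_pdivrMr// ler_peMr// ltW.
apply: (le_trans (Phi_le_powR _ _ (divr_gt0 q0 s0) h)).
have -> : Num.sqrt N / s / Num.sqrt N = s^-1.
  by field; rewrite !gt_eqF.
rewrite -powR_inv1; last exact: ltW.
rewrite -powRrM mulN1r powRN ler_pdivrMr; last exact: powR_gt0.
by rewrite mulrC -ler_pdivrMr// -rE.
Qed.

End growth.

Section modular_bounds.
Context {R : realType} {d : nat} (Omega : set 'rV[R]_d).
Hypothesis cOmega : compact Omega.
Variable mu : probability (borel 'rV[R]_d) R.
Hypothesis muOmega : mu Omega = 1%E.
Context (Phi : R -> R).
Hypothesis PhiP : Phi_function Phi.

Lemma measurable_Phi_normc (h : 'rV[R]_d -> Cplx R) lambda : 0 < lambda ->
  {within Omega, continuous h} ->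
  measurable_fun (Omega : set (borel 'rV[R]_d))
    ((fun t => (Phi (Normc.normc (h t) / lambda))%:E)
       : borel 'rV[R]_d -> \bar R).
Proof.
move=> l0 ch.
(* [Phi] is monotone on the nonnegative half-line only. *)
pose Psi s := Phi (Num.max s 0).
have mPsi : measurable_fun setT Psi.
  apply: nondecreasing_measurable => // s t st.
  apply: (Phi_homo _ PhiP); first by rewrite le_max lexx orbT.
  by rewrite ge_max !le_max st lexx orbT.
rewrite (_ : (fun _ => _) = EFin \o (Psi \o (fun t => Normc.normc (h t) / lambda))).
  apply/measurable_EFinP; apply: measurableT_comp => //.
  apply: within_continuous_measurable => //.
  rewrite (_ : (fun _ => _) = fun t => Num.sqrt (sqnorm (h t)) * lambda^-1).
    apply: within_continuousM; last by move=> x; exact: cvg_cst.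
    apply: (@within_continuous_comp _ _ _ Omega (fun t => sqnorm (h t)) Num.sqrt).
      by move=> x _; exact: sqrt_continuous.
    exact: within_continuous_sqnorm.
  by apply/funext => t; rewrite normcE_sqrt.
apply/funext => t; rewrite /Psi /= max_l//.
by rewrite divr_ge0 ?normc_ge0 ?ltW.
Qed.

Lemma modular_le (h : 'rV[R]_d -> Cplx R) (g : 'rV[R]_d -> R) lambda :
  0 < lambda -> {within Omega, continuous h} -> {within Omega, continuous g} ->
  (forall t, Omega t -> Phi (Normc.normc (h t) / lambda) <= g t) ->
  (modular mu Omega Phi h lambda <= (\int[mu]_(t in Omega) g t)%:E)%E.
Proof.
move=> l0 ch cg hg; have mO := compact_measurable Omega cOmega.
have ig := within_continuous_integrable Omega cOmega mu g cg.
rewrite /Rintegral fineK; last exact: integrable_fin_num.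
apply: ge0_le_integral => //.
- move=> t _; rewrite lee_fin; apply: Phi_ge0 => //.
  by rewrite divr_ge0 ?normc_ge0 ?ltW.
- exact: measurable_Phi_normc.
- by apply/measurable_EFinP; exact: within_continuous_measurable.
Qed.

Lemma within_continuous_in_LPhi (h : 'rV[R]_d -> Cplx R) :
  {within Omega, continuous h} -> in_LPhi mu Omega Phi h.
Proof.
move=> ch; split; first exact: within_continuous_borel_measurable.
have [K K0 HK] := compact_bounded_fun Omega _ cOmega (within_continuous_sqnorm Omega h ch).
exists 1 => //.
apply: (le_lt_trans (modular_le h (fun=> Phi (Num.sqrt K)) 1 _ _ _ _)) => //.
- by move=> x; exact: cvg_cst.
- move=> t Ot; rewrite divr1; apply: (Phi_homo _ PhiP); first exact: normc_ge0.
  by rewrite normcE_sqrt ler_wsqrtr// (le_trans (ler_norm _))// HK.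
- exact: ltry.
Qed.

Lemma sqnormB (x y : R[i]) : sqnorm (x - y) <= 2 * sqnorm x + 2 * sqnorm y.
Proof.
case: x => a b; case: y => a' b'; rewrite /sqnorm /=.
have := sqr_ge0 (a + a'); have := sqr_ge0 (b + b'); lra.
Qed.

Context (p : R).
Hypothesis p2 : 2 <= p.
Hypothesis Phip : forall s t : R, 0 < s -> s <= t ->
  Phi s * s `^ (- p) <= Phi t * t `^ (- p).

(** [h] plays the part of the recovery error and [w] that of its component in the
    approximating subspace.  The parameter of the modular is [20 s e], chosen so
    that [|h| / (20 s e)] is at most [M = sqrt N / s], as
    [|h|^2 <= (2 + 384 N) e^2 <= 400 N e^2]. *)
Lemma LPhi_norm_le (h w : 'rV[R]_d -> Cplx R) (N e s : R) :
  0 < N -> 1 <= N -> 0 < e -> 0 < s ->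
  {within Omega, continuous h} -> {within Omega, continuous w} ->
  (forall t, Omega t -> sqnorm (h t) <= 2 * e ^+ 2 + 2 * sqnorm (w t)) ->
  (forall t, Omega t -> sqnorm (w t) <= 192 * N * e ^+ 2) ->
  \int[mu]_(t in Omega) sqnorm (w t) <= 16 * e ^+ 2 ->
  Phi (Num.sqrt N / s) <= N ->
  (LPhi_norm mu Omega Phi h <= (20 * s * e)%:E)%E.
Proof.
move=> N0 N1 e0 s0 ch cw hw wN wI PN.
have l0 : 0 < 20 * s * e by rewrite !mulr_gt0.
have e2 : 0 < e ^+ 2 by rewrite exprn_gt0.
apply: ge_ereal_inf; exists (20 * s * e)%:E => //; exists (20 * s * e) => //; split=> //.
pose M := Num.sqrt N / s.
have M0 : 0 < M by rewrite divr_gt0// sqrtr_gt0.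
have [D DE] : exists D, D = 400 * N * e ^+ 2 by exists (400 * N * e ^+ 2).
have D0 : 0 < D by rewrite DE; have := mulr_gt0 N0 e2; lra.
have lM : (20 * s * e * M) ^+ 2 = D.
  rewrite DE /M; have -> : 20 * s * e * (Num.sqrt N / s) = 20 * e * Num.sqrt N.
    by field; exact: lt0r_neq0.
  by rewrite exprMn sqr_sqrtr ?ltW//; ring.
pose k := Phi M / D.
have PM0 : 0 <= Phi M by apply: Phi_ge0 => //; exact: ltW.
have k0 : 0 <= k by rewrite divr_ge0// ltW.
have cg : {within Omega, continuous (fun t => k * (2 * e ^+ 2 + 2 * sqnorm (w t)))}.
  apply: within_continuousM; first by move=> x; exact: cvg_cst.
  apply: (@within_continuousD _ _ _ Omega (fun=> 2 * e ^+ 2) (fun t => 2 * sqnorm (w t))).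
    by move=> x; exact: cvg_cst.
  apply: within_continuousM; first by move=> x; exact: cvg_cst.
  exact: within_continuous_sqnorm.
apply: (le_trans (modular_le _ _ _ l0 ch cg _)).
  move=> t Ot; have h1 := hw t Ot; have w1 := wN t Ot.
  have hM : sqnorm (h t) <= D.
    rewrite DE; apply: (le_trans h1); have : e ^+ 2 <= N * e ^+ 2 by rewrite ler_peMl// ltW.
    by lra.
  have hl : Normc.normc (h t) / (20 * s * e) <= M.
    rewrite ler_pdivrMr// -(ler_pXn2r (ltn0Sn 1)) ?nnegrE ?normc_ge0//; last first.
      by rewrite mulr_ge0 ?ltW.
    by rewrite normc_sqr [M * _]mulrC lM.
  have hn : 0 <= Normc.normc (h t) / (20 * s * e) by rewrite divr_ge0 ?normc_ge0 ?ltW.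
  apply: (le_trans (Phi_le_sqr _ _ PhiP p2 Phip _ _ M0 hn hl)).
  rewrite /k -[leRHS]mulrA; apply: ler_wpM2l => //.
  rewrite -[_ / _ / M]mulrA -invfM expr_div_n normc_sqr lM mulrC.
  by rewrite ler_wpM2l// invr_ge0 ltW.
have mO := compact_measurable Omega cOmega.
have iw := within_continuous_integrable Omega cOmega mu _ (within_continuous_sqnorm Omega w cw).
have ic c : mu.-integrable Omega (EFin \o (fun=> c : R)).
  by apply: within_continuous_integrable => // x; exact: cvg_cst.
have i2w : mu.-integrable Omega (EFin \o (fun t => 2 * sqnorm (w t))).
  exact: (integrableZl mO 2 iw).
have isum : mu.-integrable Omega (EFin \o (fun t => 2 * e ^+ 2 + 2 * sqnorm (w t))).
  exact: (integrableD mO (ic (2 * e ^+ 2)) i2w).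
rewrite lee_fin RintegralZl// RintegralD// (RintegralZl 2 mO iw) Rintegral_cst//.
have -> : fine (mu Omega) = 1 by transitivity (fine (1%E : \bar R)); [congr fine|].
(* 34 = 2 + 2 * 16, and the factor [N] in [k] absorbs [Phi M]. *)
apply: (@le_trans _ _ (k * (34 * e ^+ 2))).
  by apply: ler_wpM2l => //; lra.
rewrite /k mulrAC ler_pdivrMr// mul1r.
rewrite DE mulrA ler_pM2r//.
by move: PN; rewrite -/M; lra.
Qed.

End modular_bounds.

(** * Sampling numbers and Kolmogorov widths *)

Lemma kolmogorov_approximant {R : realType} {X : topologicalType} (D : set X)
    (f : X -> Cplx R) (V : set (X -> Cplx R)) (e : R) :
  (ereal_inf [set sup_norm D (fun t => f t - u t)%R | u in V] < e%:E)%E ->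
  exists2 u, V u & forall t, D t -> Normc.normc (f t - u t) <= e.
Proof.
move=> /ereal_inf_lt[_ [u Vu <-] ue]; exists u => // t Dt.
rewrite -lee_fin; apply: le_trans (ltW ue).
by have /ereal_supP := lexx (sup_norm D (fun t => f t - u t)); apply; exists t.
Qed.

(** One operator serves all [e], so that approximants of [F] may come arbitrarily
    close to the best ones without changing the sampling points. *)
Lemma exists_recovery_operator {R : realType} {d : nat} (Omega : set 'rV[R]_d)
    (mu : probability (borel 'rV[R]_d) R) (Phi : R -> R) (p : R)
    (F : set ('rV[R]_d -> Cplx R)) (N : nat) (b : 'I_N -> 'rV[R]_d -> Cplx R) :
  compact Omega -> mu Omega = 1%E -> Phi_function Phi -> 2 <= p ->
  (forall s t : R, 0 < s -> s <= t -> Phi s * s `^ (- p) <= Phi t * t `^ (- p)) ->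
  F `<=` continuous_on Omega -> (1 <= N)%N ->
  (forall i, continuous_on Omega (b i)) ->
  (forall a : 'I_N -> R[i],
     (forall t, Omega t -> \sum_i a i * b i t = 0) -> forall i, a i = 0) ->
  exists k (x : 'I_k -> 'rV[R]_d) (A : 'rV[R[i]]_k -> 'rV[R]_d -> Cplx R),
    [/\ (k <= 8 * N)%N, injective x, forall i, Omega (x i),
      linear_to_LPhi mu Omega Phi A &
      forall s e f, 0 < s -> 0 < e -> Phi (Num.sqrt N%:R / s) <= N%:R -> F f ->
        (exists a : 'I_N -> R[i], forall t, Omega t ->
          Normc.normc (f t - \sum_i a i * b i t) <= e) ->
        (LPhi_norm mu Omega Phi (fun t => f t - A (\row_i f (x i)) t)%R
          <= (20 * s * e)%:E)%E].
Proof.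
move=> cO muO PhiP p2 Phip FO N1 cb freeb.
have [k [x [coef [km xinj Ox lin rec]]]] :=
  exists_sampling_operator Omega cO mu muO b N1 cb freeb.
exists k, x, (fun v => lincomb b (coef v)); split=> //.
  split=> [v|a v w]; last by apply: aeW => t _; rewrite lin lincombD lincombZ.
  apply: within_continuous_in_LPhi => //; exact: within_continuous_lincomb.
move=> s e f s0 e0 PN Ff [a fa].
have fa' t : Omega t -> Normc.normc (f t - lincomb b (\row_i a i) t) <= e.
  move=> Ot; rewrite /lincomb; under eq_bigr do rewrite mxE; exact: fa.
have [I1 I2] := rec f (\row_i a i) e (ltW e0) fa'.
set v := \row_i f (x i); set u := coef v - \row_i a i in I1 I2.
have NR : 1 <= N%:R :> R by rewrite ler1n.
apply: (LPhi_norm_le Omega cO mu muO Phi PhiP p p2 Phip _ (lincomb b u) N%:R) => //.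
- exact: lt_le_trans ltr01 NR.
- apply: (@within_continuousB _ _ _ Omega f (lincomb b (coef v))); first exact: FO.
  exact: within_continuous_lincomb.
- exact: within_continuous_lincomb.
move=> t Ot; have -> : f t - lincomb b (coef v) t
    = (f t - lincomb b (\row_i a i) t) - lincomb b u t.
  by rewrite /u lincombB opprB addrA subrK.
apply: (le_trans (sqnormB _ _)); rewrite lerD2r ler_pM2l//.
by rewrite -normc_sqr ler_pXn2r// ?nnegrE ?normc_ge0 ?(ltW e0)//; exact: fa'.
Qed.

Theorem theorem1p3 (R : realType) :
  exists2 c : R, 1 <= c &
    forall (Phi : R -> R) (p : R),
      Phi_function Phi ->
      2 <= p ->
      (forall s t : R, 0 < s -> s <= t ->
         Phi s * s `^ (- p) <= Phi t * t `^ (- p)) ->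
      exists2 C : R, 1 <= C &
        forall (d : nat) (Omega : set 'rV[R]_d)
               (mu : probability (borel 'rV[R]_d) R)
               (F : set ('rV[R]_d -> Cplx R)) (N : nat),
          compact Omega ->
          mu Omega = 1%E ->
          F `<=` continuous_on Omega ->
          (1 <= N)%N ->
          (* without this the right-hand side degenerates to 0 *)
          0 < Phi (Num.sqrt N%:R) ->
          (sampling_number mu Omega Phi F (c * N%:R)
             <= (C * (Phi (Num.sqrt N%:R) / N%:R) `^ p^-1)%:E
                * kolmogorov_width Omega F N)%E.
Proof.
exists 8; first by rewrite ler1n.
move=> Phi p PhiP p2 Phip.
have [kappa k0 kappaP] := Phi_ratio_lower_bound Phi p PhiP p2 Phip.
have p0 : 0 < p by lra.
(* The second entry makes [s] below at least 1, the first one [s `^ p >= r]. *)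
pose C0 := Num.max 1 (kappa `^ (- p^-1)).
have C01 : 1 <= C0 by rewrite le_max lexx.
exists (20 * C0); first by lra.
move=> d Omega mu F N cO muO FO N1 PN.
have N0 : 0 < N%:R :> R by rewrite ltr0n.
set r := Phi _ / _; have r0 : 0 < r by exact: divr_gt0.
have kr : kappa <= r by exact: kappaP.
pose s := C0 * r `^ p^-1.
have s1 : 1 <= s.
  apply: (@le_trans _ _ (kappa `^ (- p^-1) * kappa `^ p^-1)).
    rewrite -powRD; first by rewrite addNr powRr0.
    by apply/implyP => _; rewrite gt_eqF.
  apply: ler_pM; rewrite ?powR_ge0 ?le_max ?lexx ?orbT//.
  by apply: ge0_ler_powR; rewrite ?nnegrE ?invr_ge0 //; exact: ltW.
have s0 := lt_le_trans ltr01 s1.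
have rs : r <= s `^ p.
  rewrite /s powRM ?powR_ge0 ?(le_trans ler01)// -powRrM mulVf ?gt_eqF//.
  rewrite (powRr1 (ltW r0)) ler_peMl ?(ltW r0)//.
  have := ge0_ler_powR (ltW p0) _ _ C01; rewrite powR1; apply; rewrite nnegrE//.
  exact: le_trans C01.
have Ps : Phi (Num.sqrt N%:R / s) <= N%:R.
  exact: (Phi_rescaled_le Phi p Phip N%:R r s).
have -> : 20 * C0 * r `^ p^-1 = 20 * s by rewrite /s mulrA.
have K0 : 0 < 20 * s by rewrite mulr_gt0.
rewrite -lee_pdivrMl//; apply/ereal_infP => w [V [b [cb freeb VE]] <-{w}].
set w := ereal_sup _; rewrite lee_pdivrMl//.
have [k [x [A [km xinj Ox linA recA]]]] :=
  exists_recovery_operator Omega mu Phi p F N b cO muO PhiP p2 Phip FO N1 cb freeb.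
have sampling_le z : (recovery_error mu Omega Phi F x A <= z)%E ->
    (sampling_number mu Omega Phi F (8 * N%:R) <= z)%E.
  move=> Az; apply: ge_ereal_inf.
  exists (ereal_inf [set recovery_error mu Omega Phi F x A | A in @linear_to_LPhi _ _ _ mu Omega Phi k]).
    exists k, x; split=> //; rewrite -natrM ler_nat; exact: km.
  by apply: ge_ereal_inf; exists (recovery_error mu Omega Phi F x A) => //; exists A.
(* For empty [F] the supremum [w] is -oo, so no positive [e] could approach it. *)
have [F0|/set0P[f0 Ff0]] := eqVneq F set0.
  apply: sampling_le; rewrite /recovery_error F0 image_set0 ereal_sup0.
  exact: leNye.
have fw f : F f ->
    (ereal_inf [set sup_norm Omega (fun t => f t - u t)%R | u in V] <= w)%E.
  by move=> Ff; have /ereal_supP := lexx w; apply; exists f.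
have w0 : (0 <= w)%E.
  apply: le_trans (fw _ Ff0); apply/ereal_infP => _ [u _ <-].
  have [Om0|/set0P[t Ot]] := eqVneq Omega set0.
    by move: muO; rewrite Om0 measure0 => /eqP; rewrite eqe eq_sym oner_eq0.
  apply: (@le_trans _ _ (Normc.normc (f0 t - u t))%:E); first by rewrite lee_fin normc_ge0.
  by have /ereal_supP := lexx (sup_norm Omega (fun t => f0 t - u t)); apply; exists t.
clearbody w; case: w w0 fw => [w|_ _|//]; last by rewrite gt0_muley ?lte_fin// leey.
rewrite lee_fin => w0 fw; rewrite -EFinM; apply/lee_addgt0Pr => e e0.
rewrite -EFinD; apply: sampling_le; apply/ereal_supP => _ [f Ff <-].
(* The width need not be attained, and it may be 0; hence the excess
   [e / (20 * s)]. *)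
have e'0 : 0 < w + e / (20 * s) by rewrite ltr_wpDl// divr_gt0.
have -> : 20 * s * w + e = 20 * s * (w + e / (20 * s)).
  by field; rewrite gt_eqF.
apply: recA => //.
have [|u] := @kolmogorov_approximant R _ Omega f V (w + e / (20 * s)).
  by apply: (le_lt_trans (fw _ Ff)); rewrite lte_fin ltrDl divr_gt0.
by rewrite VE => -[a ->] fa; exists a.
Qed.
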